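(* Let $a$ and $k$ be positive integers. Define $F^{(a)}_1=F^{(a)}_2=1$ and $F^{(a)}_n=aF^{(a)}_{n-1}+F^{(a)}_{n-2}$ for $n\ge3$. Then for Lebesgue-almost all real numbers $x$, $$\lim_{n\to\infty}\frac1n\#\{1\le i\le n: a_{i+1}(x)=a_{i+2}(x)=\cdots=a_{i+k}(x)=a\}=\left|\log_2\left(1+\frac{(-1)^k}{\bigl(F^{(a)}_{k+2}\bigr)^2}\right)\right|.$$ In particular, for $a=1$ this limit equals $\left|\log_2\left(1+\frac{(-1)^k}{F_{k+2}^2}\right)\right|$ for almost all $x$, where $F_n$ is the $n$th Fibonacci number ($F_1=F_2=1$, $F_n=F_{n-1}+F_{n-2}$).
   Context: Every irrational real number $x$ has a unique infinite continued fraction expansion $x=a_0+\cfrac{1}{a_1+\cfrac{1}{a_2+\cdots}}=[a_0;a_1,a_2,\dots]$ with $a_0=\lfloor x\rfloor\in\mathbb{Z}$ and $a_i=a_i(x)$ positive integers for $i\ge1$; the $a_i(x)$, $i\ge 1$, are called the continued fraction digits of $x$. $\log_2$ denotes the base-2 logarithm. *)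

(* Defs.v *)
From mathcomp Require Import all_boot all_order all_algebra.
From mathcomp Require Import all_classical all_reals all_analysis.

Set Implicit Arguments.
Unset Strict Implicit.
Unset Printing Implicit Defensive.

Import Order.TTheory GRing.Theory Num.Theory.
Import numFieldNormedType.Exports.

Local Open Scope classical_set_scope.
Local Open Scope ring_scope.

Section ContinuedFraction.
Variable R : realType.

(* [cf_finite a n] is [a_0; a_1, ..., a_n]. *)
Fixpoint cf_finite (a : nat -> int) (n : nat) : R :=
  if n is n'.+1 then (a 0)%:~R + (cf_finite (fun i => a i.+1) n')^-1
  else (a 0)%:~R.

(* x = [a_0; a_1, a_2, ...]: the infinite continued fraction is the limit of
   its finite truncations. *)
Definition cf_expansion (x : R) (a : nat -> int) : Prop :=
  [/\ a 0 = Num.floor x,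
      forall i, (0 < i)%N -> 0 < a i &
      cf_finite a n @[n --> \oo] --> x].

(* The expansion exists and is unique exactly when x is irrational; for
   rational x there is none, and the digits take the junk value 0. *)
Definition cf_digit (x : R) : nat -> int :=
  xget (fun=> 0) [set a | cf_expansion x a].

Definition cf_run_count (a k : nat) (x : R) (n : nat) : nat :=
  count (fun i => [forall j : 'I_k, cf_digit x (i + j.+1) == a%:Z]) (iota 1 n).

Definition log2 (y : R) : R := ln y / ln 2.

End ContinuedFraction.

(* F^(a)_n, indexed from n = 1; the value at n = 0 is junk. *)
Fixpoint genfib (a n : nat) : nat :=
  match n with
  | 0 => 0
  | n'.+1 =>
    match n' with
    | 0 => 1
    | n''.+1 =>
      if n'' is 0 then 1 else a * genfib a n' + genfib a n''
    end
  end%N.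

Lemma genfib1 a : genfib a 1 = 1%N. Proof. by []. Qed.

Lemma genfib2 a : genfib a 2 = 1%N. Proof. by []. Qed.

Lemma genfibE a n : (3 <= n)%N ->
  genfib a n = (a * genfib a n.-1 + genfib a n.-2)%N.
Proof. by case: n => [|[|[|n]]]. Qed.

Fixpoint fib (n : nat) : nat :=
  match n with
  | 0 => 0
  | n'.+1 => if n' is n''.+1 then fib n' + fib n'' else 1
  end%N.

(* Main.v *)
Require Import Defs.
From mathcomp Require Import all_boot all_order all_algebra.
From mathcomp Require Import all_classical all_reals all_analysis.
From mathcomp Require Import zify ring lra.
Set Implicit Arguments.
Unset Strict Implicit.
Unset Printing Implicit Defensive.
Import Order.TTheory GRing.Theory Num.Theory.
Import numFieldNormedType.Exports.
Import measurable_realfun.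
Local Open Scope classical_set_scope.
Local Open Scope ring_scope.

(* Under Lebesgue measure on an interval [z, z + 1) the continued fraction
   digits are driven by a Markov chain: given the first n digits, the next one
   is b + 1 with probability
     p_b(s) = (1 + s) / ((b + 1 + s) (b + 2 + s)),  s = q_(n-1) / q_n,
   and the state s moves to 1 / (b + 1 + s).  The transition operator
     U h (s) = sum_b p_b(s) h(1 / (b + 1 + s))
   contracts Lipschitz constants by 7/8, so U^m h converges geometrically fast
   to a constant, and runs of digits are almost independent when far apart.
   Hence the variance of the number of runs up to n is O(n); the averages then
   converge almost everywhere along n = m^2, and along all n since the counts
   increase by at most 1.
   The limit is found without integration: with
     f_t(s) = (1 + s) t / (1 + s t),  k_t(s) = (1 + s) (1 + t) / (1 + s t)^2,
   U acts on the kernel k_t(s) in the same way in s and in t, so lim U^m k_t is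
   U-fixed as a function of t, hence constant; as f_t has t-derivative
   k_t / (1 + t), this forces lim U^m f_t = log2 (1 + t). *)

(** * Transfer operator of the Gauss map *)

Section TransferOperator.
Variable R : realType.
Implicit Types (b m n : nat) (s t : R) (h : R -> R).

Definition dprob b s : R := (1 + s) / ((b.+1%:R + s) * (b.+2%:R + s)).
Definition dmap b s : R := (b.+1%:R + s)^-1.
(** Probability, from state [s], that the next digit exceeds [n]. Digits are shifted by one
    throughout: index [b] stands for digit [b + 1]. *)
Definition dtail n s : R := (1 + s) / (n.+1%:R + s).
Definition transfer h s : R :=
  limn (series (fun b => dprob b s * h (dmap b s))).

Definition unit_lip (L : R) h :=
  forall s t, 0 <= s <= 1 -> 0 <= t <= 1 -> `|h s - h t| <= L * `|s - t|.

Lemma natS_gt0 b s : 0 <= s -> 0 < b.+1%:R + s.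
Proof. by move=> s0; rewrite ltr_wpDr // ltr0n. Qed.

Lemma dprob_ge0 b s : 0 <= s -> 0 <= dprob b s.
Proof.
by move=> s0; apply: divr_ge0; rewrite ?mulr_ge0 // addr_ge0.
Qed.

Lemma dmap01 b s : 0 <= s <= 1 -> 0 <= dmap b s <= 1.
Proof.
move=> /andP[s0 s1]; rewrite invr_ge0 ltW ?natS_gt0 //= invf_le1 ?natS_gt0 //.
by rewrite -natr1 -addrA addrC -addrA lerDl addr_ge0.
Qed.

(** Partial fractions: the probabilities telescope, which gives their partial sums in closed form
    and later allows summation by parts. *)
Lemma dprobE b s : 0 <= s -> dprob b s = dtail b s - dtail b.+1 s.
Proof.
move=> s0; rewrite /dprob /dtail.
have := natS_gt0 b s0; have := natS_gt0 b.+1 s0.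
rewrite -(natr1 b.+1); set u := b.+1%:R => h1 h2; field.
by apply/andP; split; lra.
Qed.

Lemma sum_dprob n s : 0 <= s -> \sum_(0 <= b < n) dprob b s = 1 - dtail n s.
Proof.
move=> s0; elim: n => [|n IHn].
  by rewrite big_nil /dtail divff ?subrr // gt_eqF // ltr_pwDl.
by rewrite big_nat_recr //= IHn dprobE //; lra.
Qed.

Lemma dtail_ge0 n s : 0 <= s -> 0 <= dtail n s.
Proof. by move=> s0; rewrite divr_ge0 // addr_ge0. Qed.

Lemma dtail_le n s : 0 <= s <= 1 -> dtail n s <= 2 * harmonic n.
Proof.
move=> /andP[s0 s1]; rewrite /dtail /harmonic /=; apply: ler_pM => //.
- by rewrite addr_ge0.
- by rewrite invr_ge0 ltW ?natS_gt0.
- lra.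
- by rewrite lef_pV2 ?posrE ?natS_gt0 // lerDl.
Qed.

Lemma cvg_dtail s : 0 <= s <= 1 -> (dtail n s @[n --> \oo] --> (0 : R)).
Proof.
move=> s01; apply: (@squeeze_cvgr _ _ _ _ (fun=> 0) (fun n => 2 * harmonic n)).
- by apply: nearW => n; rewrite dtail_le // dtail_ge0 //; case/andP: s01.
- exact: cvg_cst.
- by rewrite -[X in _ --> X](mulr0 2); apply: cvgMr; exact: cvg_harmonic.
Qed.

Lemma cvg_sum_dprob s : 0 <= s <= 1 ->
  series (fun b => dprob b s) @ \oo --> (1 : R).
Proof.
move=> s01; have /andP[s0 s1] := s01.
have -> : series (fun b => dprob b s) = (fun n => 1 - dtail n s).
  by apply/funext => n; rewrite /series /= sum_dprob.
rewrite -[X in _ --> X](subr0 1); apply: cvgB; first exact: cvg_cst.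
exact: cvg_dtail.
Qed.

Definition unit_bnd h := exists M, forall s, 0 <= s <= 1 -> `|h s| <= M.

Lemma unit_lip_bnd L h : unit_lip L h -> unit_bnd h.
Proof.
move=> hL; exists (`|L| + `|h 0|) => s s01.
have h0 := hL s 0 s01; rewrite lexx ler01 subr0 in h0.
have /andP[s0 s1] := s01; have {}h0 := h0 isT.
have : `|h s| <= `|h s - h 0| + `|h 0|.
  by rewrite -{1}(subrK (h 0) (h s)) ler_normD.
move=> /le_trans; apply; rewrite lerD2r; apply: (le_trans h0).
rewrite (le_trans (ler_norm _)) // normrM normr_id ler_piMr //.
by rewrite ger0_norm.
Qed.

Lemma is_cvg_transfer h s : unit_bnd h -> 0 <= s <= 1 ->
  cvgn (series (fun b => dprob b s * h (dmap b s))).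
Proof.
move=> [M hM] s01; have /andP[s0 s1] := s01.
apply: normed_cvg.
apply: (@series_le_cvg _ _ (fun b => M * dprob b s)).
- by move=> n /=.
- move=> n; rewrite mulr_ge0 ?dprob_ge0 //.
  exact: le_trans (hM _ s01).
- move=> n; rewrite /= normrM (ger0_norm (dprob_ge0 n s0)) mulrC.
  by rewrite ler_wpM2r ?dprob_ge0 // hM // dmap01.
- have -> : series (fun b => M * dprob b s) = 
     (fun n => M * series (fun b => dprob b s) n).
    by apply/funext => n; rewrite /series /= mulr_sumr.
  apply: is_cvgMr; apply/cvg_ex; exists 1; exact: cvg_sum_dprob.
Qed.

Lemma cvg_transfer h s : unit_bnd h -> 0 <= s <= 1 ->
  series (fun b => dprob b s * h (dmap b s)) @ \oo --> transfer h s.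
Proof. by move=> hb s01; apply: is_cvg_transfer. Qed.

Lemma transfer_le h1 h2 s : unit_bnd h1 -> unit_bnd h2 ->
  (forall t, 0 <= t <= 1 -> h1 t <= h2 t) ->
  0 <= s <= 1 -> transfer h1 s <= transfer h2 s.
Proof.
move=> b1 b2 le12 s01; apply: lim_series_le.
- exact: is_cvg_transfer.
- exact: is_cvg_transfer.
move=> n; rewrite ler_wpM2l //; first by apply: dprob_ge0; case/andP: s01.
exact/le12/dmap01.
Qed.

Lemma transfer_ext h1 h2 s : (forall t, 0 <= t <= 1 -> h1 t = h2 t) ->
  0 <= s <= 1 -> transfer h1 s = transfer h2 s.
Proof.
move=> e12 s01; rewrite /transfer; congr (limn (series _)).
by apply/funext => b; rewrite e12 // dmap01.
Qed.

Lemma transfer_lin c h1 h2 s : unit_bnd h1 -> unit_bnd h2 -> 0 <= s <= 1 ->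
  transfer (fun t => c * h1 t + h2 t) s = c * transfer h1 s + transfer h2 s.
Proof.
move=> b1 b2 s01; apply: cvg_lim => //.
have -> : series (fun b => dprob b s * (c * h1 (dmap b s) + h2 (dmap b s))) =
  (fun n => c * series (fun b => dprob b s * h1 (dmap b s)) n +
            series (fun b => dprob b s * h2 (dmap b s)) n).
  apply/funext => n; rewrite /series /= mulr_sumr -big_split /=.
  by apply: eq_bigr => i _; ring.
apply: cvgD; last exact: cvg_transfer.
by apply: cvgMr; exact: cvg_transfer.
Qed.

Lemma unit_bnd_cst c : unit_bnd (fun=> c).
Proof. by exists `|c|. Qed.

Lemma transfer_cst c s : 0 <= s <= 1 -> transfer (fun=> c) s = c.
Proof.
move=> s01; apply: cvg_lim => //.
have -> : series (fun b => dprob b s * c) =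
  (fun n => series (fun b => dprob b s) n * c).
  by apply/funext => n; rewrite /series /= mulr_suml.
rewrite -[X in _ --> X](mul1r c); apply: cvgMl; exact: cvg_sum_dprob.
Qed.

(** * Contraction of Lipschitz constants by the transfer operator *)

Lemma abel_sum (d h : nat -> R) n :
  \sum_(0 <= b < n) (d b - d b.+1) * h b =
  d 0 * h 0 - d n * h n + \sum_(0 <= b < n) d b.+1 * (h b.+1 - h b).
Proof.
elim: n => [|n IHn]; first by rewrite !big_nil subrr addr0.
by rewrite !big_nat_recr //= IHn; ring.
Qed.

Lemma dmapB b s t : 0 <= s -> 0 <= t ->
  dmap b s - dmap b t = (t - s) / ((b.+1%:R + s) * (b.+1%:R + t)).
Proof.
move=> s0 t0; rewrite /dmap.
have := natS_gt0 b s0; have := natS_gt0 b t0; set u := b.+1%:R => h1 h2.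
by field; apply/andP; split; lra.
Qed.

Lemma dtailB b s t : 0 <= s -> 0 <= t ->
  dtail b s - dtail b t = (s - t) * b%:R / ((b.+1%:R + s) * (b.+1%:R + t)).
Proof.
move=> s0 t0; rewrite /dtail.
have := natS_gt0 b s0; have := natS_gt0 b t0.
rewrite -(natr1 b); set u := b%:R => h1 h2.
by field; apply/andP; split; lra.
Qed.

(** The term [b = 0] is at most [1 / (2 + s)]. For [b >= 1] the denominator is at least 4, so these
    terms add up to at most a quarter of the tail [(1 + s) / (2 + s)]. The total
    [(5 + s) / (4 (2 + s))] is largest at [s = 0], where it equals 5/8. *)
Lemma sum_contr1 n s t : 0 <= s <= 1 -> 0 <= t <= 1 ->
  \sum_(0 <= b < n) dprob b s / ((b.+1%:R + s) * (b.+1%:R + t)) <= 5 / 8.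
Proof.
move=> /andP[s0 s1] /andP[t0 t1].
(* Subtracting a quarter of the tail not yet summed makes the bound inductive. *)
suff H : \sum_(0 <= b < n.+1) dprob b s / ((b.+1%:R + s) * (b.+1%:R + t))
    <= 5 / 8 - dtail n.+1 s / 4.
  apply: (@le_trans _ _ (5 / 8 - dtail n.+1 s / 4)).
    apply: (le_trans _ H); rewrite [leRHS]big_nat_recr //= lerDl.
    by rewrite divr_ge0 ?dprob_ge0 ?mulr_ge0 ?addr_ge0.
  have := dtail_ge0 n.+1 s0; lra.
elim: n => [|n IHn].
  rewrite big_nat1 /dprob /dtail.
  apply: (@le_trans _ _ ((2 + s)^-1)).
    have -> : (1 + s) / ((1 + s) * (2 + s)) / ((1 + s) * (1 + t)) =
      (2 + s)^-1 * ((1 + s) * (1 + t))^-1.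
      by field; rewrite !lt0r_neq0 //; lra.
    rewrite ler_piMr ?invr_ge0 ?invf_le1; nra.
  rewrite -subr_ge0.
  have -> : 5 / 8 - (1 + s) / (2 + s) / 4 - (2 + s)^-1 = 3 * s / (8 * (2 + s)).
    by field; lra.
  by rewrite divr_ge0 //; lra.
rewrite big_nat_recr //=.
have h4 : dprob n.+1 s / ((n.+2%:R + s) * (n.+2%:R + t)) <= dprob n.+1 s / 4.
  rewrite ler_wpM2l ?dprob_ge0 // lef_pV2 ?posrE ?mulr_gt0 ?natS_gt0 //.
  have : (0 : R) <= n%:R by []. rewrite -(natr1 n.+1) -(natr1 n) => hn; nra.
have := dprobE n.+1 s0; lra.
Qed.

(** Each summand is at most [D L / (b + 2)^3], hence at most [D L / ((b + 1) (b + 2) (b + 3))], and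
    the latter telescopes to a sum below [D L / 4]. *)
Lemma sum_contr2 n (D L : R) (d h : nat -> R) : 0 <= D -> 0 <= L ->
  (forall b, `|d b| <= D * b%:R / b.+1%:R ^+ 2) ->
  (forall b, `|h b.+1 - h b| <= L / (b.+1%:R * b.+2%:R)) ->
  \sum_(0 <= b < n) `|d b.+1 * (h b.+1 - h b)| <= D * L / 4.
Proof.
move=> D0 L0 hd hh.
suff H : \sum_(0 <= b < n) `|d b.+1 * (h b.+1 - h b)| <=
    D * L * (2^-1 * (2^-1 - (n.+1%:R * n.+2%:R)^-1)).
  apply: (le_trans H); rewrite ler_wpM2l ?mulr_ge0 //.
  have : 0 <= ((n.+1%:R * n.+2%:R)^-1 : R) by rewrite invr_ge0.
  move: ((_ * _)^-1 : R) => u; lra.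
elim: n => [|n IHn].
  by rewrite big_nil mul1r subrr !mulr0.
rewrite big_nat_recr //=.
apply: (le_trans (lerD IHn _)).
  by rewrite normrM; apply: ler_pM.
have -> : (D * n.+1%:R / n.+2%:R ^+ 2 * (L / (n.+1%:R * n.+2%:R))) =
  D * L * (n.+2%:R ^+ 3)^-1 :> R.
  by rewrite -(natr1 n.+1); set v := n.+1%:R; have : 0 < v by []; move=> ?;
    field; rewrite !lt0r_neq0 //; lra.
rewrite -mulrDr ler_wpM2l ?mulr_ge0 //.
have hn : (0 : R) <= n%:R by [].
rewrite -(natr1 n.+2) -(natr1 n.+1) -(natr1 n).
set u := n%:R in hn *.
have -> : 2^-1 * (2^-1 - ((u + 1 + 1) * (u + 1 + 1 + 1))^-1) =
 2^-1 * (2^-1 - ((u + 1) * (u + 1 + 1))^-1) +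
   ((u + 1) * (u + 1 + 1) * (u + 1 + 1 + 1))^-1.
  by field; do ?[apply/andP; split]; lra.
rewrite lerD2l lef_pV2 ?posrE ?exprn_gt0 ?mulr_gt0 //; nra.
Qed.

Lemma dtailB_le b s t : 0 <= s -> 0 <= t ->
  `|dtail b s - dtail b t| <= `|s - t| * b%:R / b.+1%:R ^+ 2.
Proof.
move=> s0 t0; rewrite dtailB // !normrM normfV.
rewrite [X in _ * X * _ <= _]ger0_norm // ler_wpM2l ?mulr_ge0 //.
rewrite ger0_norm ?mulr_ge0 ?addr_ge0 // lef_pV2 ?posrE ?mulr_gt0 ?natS_gt0 //.
by rewrite expr2 ler_pM // lerDl.
Qed.

Lemma unit_lip_ge0 L h : unit_lip L h -> 0 <= L.
Proof.
move=> /(_ 0 1); rewrite !lexx !ler01 /= sub0r normrN1 mulr1 => H.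
exact: le_trans (normr_ge0 _) (H isT isT).
Qed.

(** The factor is 7/8 = 5/8 + 1/4. Moving only the arguments of [h] costs 5/8 by [sum_contr1].
    Moving only the weights is summed by parts, so that [h] enters through its differences at
    consecutive branches, which costs 1/4 by [sum_contr2]. *)
Lemma transfer_lip L h : unit_lip L h -> unit_lip (7 / 8 * L) (transfer h).
Proof.
move=> hL s t s01 t01.
have hb := unit_lip_bnd hL.
have [M hM] := hb.
have /andP[s0 s1] := s01; have /andP[t0 t1] := t01.
have L0 : 0 <= L.
  exact: unit_lip_ge0 hL.
pose u n := \sum_(0 <= b < n) dprob b s * h (dmap b s)
          - \sum_(0 <= b < n) dprob b t * h (dmap b t).
have cu : u @ \oo --> transfer h s - transfer h t.
  by apply: cvgB; exact: cvg_transfer.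
have uB n : `|u n| <= 7 / 8 * L * `|s - t| + 2 * harmonic n * M * 2.
  have -> : u n = \sum_(0 <= b < n) dprob b s * (h (dmap b s) - h (dmap b t)) +
     \sum_(0 <= b < n) ((dtail b s - dtail b t) - (dtail b.+1 s - dtail b.+1 t))
        * h (dmap b t).
    rewrite /u -sumrB -big_split /=; apply: eq_bigr => b _.
    by rewrite !dprobE //; ring.
  rewrite abel_sum.
  (* The full tail is 1 in every state, so the boundary term at 0 vanishes; the one at [n], called
     [C] below, tends to 0. *)
  have -> : dtail 0 s - dtail 0 t = 0.
    by rewrite /dtail !divff ?subrr // gt_eqF // ltr_pwDl.
  rewrite mul0r sub0r.
  set A := \sum_(0 <= b < n) _; set B := \sum_(0 <= b < n) _.
  set C := _ * h _.
  have hA : `|A| <= 5 / 8 * (L * `|s - t|).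
    apply: (le_trans (ler_norm_sum _ _ _)).
    apply: (@le_trans _ _ (\sum_(0 <= b < n) dprob b s /
        ((b.+1%:R + s) * (b.+1%:R + t)) * (L * `|s - t|))).
      apply: ler_sum => b _; rewrite normrM ger0_norm ?dprob_ge0 //.
      rewrite -[leRHS]mulrA ler_wpM2l ?dprob_ge0 //.
      apply: (le_trans (hL _ _ (dmap01 b s01) (dmap01 b t01))).
      rewrite dmapB // normrM distrC.
      have X0 : 0 <= ((b.+1%:R + s) * (b.+1%:R + t))^-1.
        by rewrite invr_ge0 mulr_ge0 // addr_ge0.
      rewrite (ger0_norm X0); move: (_^-1) `|s - t| => x y.
      by have -> : L * (y * x) = x * (L * y) by ring.
    by rewrite -mulr_suml ler_wpM2r ?mulr_ge0 // sum_contr1.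
  have hB : `|B| <= `|s - t| * L / 4.
    apply: (le_trans (ler_norm_sum _ _ _)).
    apply: (@sum_contr2 n _ L (fun b => dtail b s - dtail b t)
       (fun b => h (dmap b t))) => // b; first exact: dtailB_le.
    apply: (le_trans (hL _ _ (dmap01 b.+1 t01) (dmap01 b t01))).
    rewrite ler_wpM2l //.
    have -> : dmap b.+1 t - dmap b t = - ((b.+1%:R + t) * (b.+2%:R + t))^-1.
      rewrite /dmap; have := natS_gt0 b t0; have := natS_gt0 b.+1 t0.
      rewrite -(natr1 b.+1); set v := b.+1%:R => h1 h2; field.
      by rewrite !lt0r_neq0 //; lra.
    rewrite normrN gtr0_norm; last by rewrite invr_gt0 mulr_gt0 ?natS_gt0.
    rewrite lef_pV2 ?posrE ?mulr_gt0 ?natS_gt0 //.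
    by rewrite ler_pM // lerDl.
  have hC : `|C| <= 2 * harmonic n * M * 2.
    rewrite /C normrM -!mulrA [X in 2 * (_ * X)]mulrC !mulrA.
    rewrite ler_pM //; last by rewrite hM // dmap01.
    apply: (le_trans (ler_normB _ _)).
    rewrite !ger0_norm ?dtail_ge0 //.
    have := dtail_le n s01; have := dtail_le n t01.
    by move: (harmonic n) (dtail n s) (dtail n t) => x y z; lra.
  have := ler_normD (- C + B) A; have := ler_normD (- C) B.
  rewrite normrN [A + _]addrC; lra.
have c2 : (7 / 8 * L * `|s - t| + 2 * harmonic n * M * 2 @[n --> \oo] -->
    7 / 8 * L * `|s - t|).
  rewrite -[X in _ --> X]addr0; apply: cvgD; first exact: cvg_cst.
  have -> : (0 : R) = 2 * 0 * M * 2 by rewrite mulr0 !mul0r.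
  by apply: cvgMl; apply: cvgMl; apply: cvgMr; exact: cvg_harmonic.
have c1 : `|u n| @[n --> \oo] --> `|transfer h s - transfer h t|.
  exact: cvg_norm.
rewrite -(cvg_lim _ c1) // -(cvg_lim _ c2) //.
apply: ler_lim; [exact: cvgP c1|exact: cvgP c2|exact: nearW].
Qed.

(** * Iterates of the transfer operator and their limit *)

Lemma iter_transfer_lip m L h : unit_lip L h ->
  unit_lip ((7 / 8) ^+ m * L) (iter m transfer h).
Proof.
move=> hL; elim: m => [|m IHm] /=; first by rewrite expr0 mul1r.
by rewrite exprS -mulrA; exact: transfer_lip.
Qed.

Lemma iter_transfer_bnd m L h : unit_lip L h -> unit_bnd (iter m transfer h).
Proof. by move=> /(iter_transfer_lip m)/unit_lip_bnd. Qed.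

Lemma iter_transfer_ext m h1 h2 s : (forall t, 0 <= t <= 1 -> h1 t = h2 t) ->
  0 <= s <= 1 -> iter m transfer h1 s = iter m transfer h2 s.
Proof.
move=> e12; elim: m s => [|m IHm] s s01 /=; first exact: e12.
exact: transfer_ext.
Qed.

Lemma iter_transfer_le m L1 L2 h1 h2 s : unit_lip L1 h1 -> unit_lip L2 h2 ->
  (forall t, 0 <= t <= 1 -> h1 t <= h2 t) ->
  0 <= s <= 1 -> iter m transfer h1 s <= iter m transfer h2 s.
Proof.
move=> l1 l2 le12; elim: m s => [|m IHm] s s01 /=; first exact: le12.
by apply: transfer_le => //; apply: iter_transfer_bnd; eassumption.
Qed.

Lemma unit_lip_cst c : unit_lip 0 (fun=> c).
Proof. by move=> s t _ _; rewrite subrr normr0 mul0r. Qed.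

Lemma unit_lip_lin c L1 L2 h1 h2 : unit_lip L1 h1 -> unit_lip L2 h2 ->
  unit_lip (`|c| * L1 + L2) (fun t => c * h1 t + h2 t).
Proof.
move=> l1 l2 s t s01 t01.
have -> : c * h1 s + h2 s - (c * h1 t + h2 t) =
  c * (h1 s - h1 t) + (h2 s - h2 t) by ring.
rewrite (le_trans (ler_normD _ _)) // mulrDl lerD ?l2 //.
by rewrite normrM -mulrA ler_wpM2l // l1.
Qed.

Lemma iter_transfer_cst m c s : 0 <= s <= 1 -> iter m transfer (fun=> c) s = c.
Proof.
elim: m s => [//|m IHm] s s01 /=.
by rewrite (@transfer_ext _ (fun=> c)) // transfer_cst.
Qed.

Lemma iter_transfer_lin m c L1 L2 h1 h2 s :
  unit_lip L1 h1 -> unit_lip L2 h2 -> 0 <= s <= 1 ->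
  iter m transfer (fun t => c * h1 t + h2 t) s =
  c * iter m transfer h1 s + iter m transfer h2 s.
Proof.
move=> l1 l2; elim: m s => [//|m IHm] s s01 /=.
by rewrite (transfer_ext IHm) // transfer_lin //; apply: iter_transfer_bnd; eassumption.
Qed.

(** On [0, 1] the function [U^m h] stays within [(7/8)^m L] of its value at [t]. Further
    applications of [U], which is monotone and fixes constants, cannot leave this band. *)
Lemma iter_transfer_osc m n L h s t : unit_lip L h -> 0 <= s <= 1 -> 0 <= t <= 1 ->
  `|iter (m + n) transfer h s - iter m transfer h t| <= (7 / 8) ^+ m * L.
Proof.
move=> hL s01 t01; rewrite addnC iterD.
have lm := iter_transfer_lip m hL.
set g := iter m transfer h in lm *; set e := (7 / 8) ^+ m * L in lm *.
have ge t' : 0 <= t' <= 1 -> `|g t' - g t| <= e.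
  move=> t'01; apply: (le_trans (lm _ _ t'01 t01)).
  have e0 : 0 <= e.
    exact: unit_lip_ge0 lm.
  rewrite ler_piMr // ler_norml; move: t01 t'01 => /andP[? ?] /andP[? ?]; lra.
have h1 := iter_transfer_cst n (g t - e) s01.
have h2 := iter_transfer_cst n (g t + e) s01.
have := @iter_transfer_le n _ _ _ _ s (unit_lip_cst (g t - e)) lm.
have := @iter_transfer_le n _ _ _ _ s lm (unit_lip_cst (g t + e)).
rewrite h1 h2 => H1 H2; rewrite ler_norml lerBrDr lerBlDr addrC [e + _]addrC H2 //.
  by rewrite H1 // => t' /ge; rewrite ler_norml => /andP[? ?]; lra.
by move=> t' /ge; rewrite ler_norml => /andP[? ?]; lra.
Qed.

(** For Lipschitz [h] this is the integral of [h] against the Gauss measure. State 0 is the one in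
    which the chain starts, before any digit is read. *)
Definition transfer_mean h : R := limn (fun m => iter m transfer h 0).

Let unit0 : 0 <= (0 : R) <= 1. Proof. by rewrite lexx ler01. Qed.

Lemma cvg_geometric78 L : (7 / 8) ^+ m * L @[m --> \oo] --> (0 : R).
Proof.
rewrite -[X in _ --> X](mul0r L); apply: cvgMl.
by apply: cvg_expr; rewrite ger0_norm; lra.
Qed.

(** Nested intervals: every [U^m h (s) - q m] lies below every [U^n h (t) + q n], so the supremum of
    the lower ends is within [q m] of [U^m h] for all [m]. *)
Lemma transfer_mean_exists L h : unit_lip L h ->
  exists l, forall m s, 0 <= s <= 1 -> `|iter m transfer h s - l| <= (7 / 8) ^+ m * L.
Proof.
move=> hL; pose q m := (7 / 8) ^+ m * L.
pose A := [set x | exists m s, 0 <= s <= 1 /\ x = iter m transfer h s - q m].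
have key m n s t : 0 <= s <= 1 -> 0 <= t <= 1 ->
    iter m transfer h s - q m <= iter n transfer h t + q n.
  move=> s01 t01.
  have := iter_transfer_osc m n hL t01 s01; have := iter_transfer_osc n m hL t01 t01.
  by rewrite addnC -/(q n) -/(q m) !ler_norml => /andP[? ?] /andP[? ?]; lra.
have hs : has_sup A.
  split; first by exists (iter 0 transfer h 0 - q 0%N), 0%N, 0.
  by exists (iter 0 transfer h 0 + q 0%N) => _ [m [s [s01 ->]]]; exact: key.
exists (sup A) => m s s01; rewrite -/(q m) ler_distlC.
apply/andP; split; first by apply: (sup_upper_bound hs); exists m, s.
by apply: sup_le_ub => [|_ [n [t [t01 ->]]]]; [case: hs|exact: key].
Qed.

Lemma cvg_transfer_mean L h : unit_lip L h ->
  iter m transfer h 0 @[m --> \oo] --> transfer_mean h.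
Proof.
move=> hL; have [l hl] := transfer_mean_exists hL.
apply: (@cvgP _ _ l); apply/cvgrPdist_le => e e0.
have /cvgrPdist_le /(_ _ e0) := cvg_geometric78 L.
apply: filterS => m; rewrite sub0r normrN distrC => /(le_trans (ler_norm _)).
by apply: le_trans; exact: hl.
Qed.

Lemma transfer_mean_bound L h m s : unit_lip L h -> 0 <= s <= 1 ->
  `|iter m transfer h s - transfer_mean h| <= (7 / 8) ^+ m * L.
Proof.
move=> hL s01; have [l hl] := transfer_mean_exists hL.
suff -> : transfer_mean h = l by exact: hl.
apply: (@cvg_unique _ (@Rhausdorff R) _ _ _ _ (cvg_transfer_mean hL)).
apply/cvgrPdist_le => e e0.
have /cvgrPdist_le /(_ _ e0) := cvg_geometric78 L.
apply: filterS => n; rewrite sub0r normrN distrC => /(le_trans (ler_norm _)).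
by apply: le_trans; exact: hl.
Qed.

Lemma transfer_mean_lin c L1 L2 h1 h2 : unit_lip L1 h1 -> unit_lip L2 h2 ->
  transfer_mean (fun t => c * h1 t + h2 t) =
  c * transfer_mean h1 + transfer_mean h2.
Proof.
move=> l1 l2; apply: cvg_lim => //.
rewrite (_ : (fun m => _) =
    (fun m => c * iter m transfer h1 0 + iter m transfer h2 0)); last first.
  by apply/funext => m; exact: iter_transfer_lin l1 l2 unit0.
apply: cvgD; first by apply: cvgMr; exact: cvg_transfer_mean l1.
exact: cvg_transfer_mean l2.
Qed.

Lemma transfer_mean_ext h1 h2 : (forall t, 0 <= t <= 1 -> h1 t = h2 t) ->
  transfer_mean h1 = transfer_mean h2.
Proof.
move=> e12; rewrite /transfer_mean; congr (limn _); apply/funext => m.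
exact: iter_transfer_ext.
Qed.

Lemma transfer_mean_cst c : transfer_mean (fun=> c) = c.
Proof.
apply: cvg_lim => //.
rewrite (_ : (fun m => _) = (fun=> c)); first exact: cvg_cst.
by apply/funext => m; rewrite iter_transfer_cst.
Qed.

Lemma transfer_mean_le L1 L2 h1 h2 : unit_lip L1 h1 -> unit_lip L2 h2 ->
  (forall t, 0 <= t <= 1 -> h1 t <= h2 t) ->
  transfer_mean h1 <= transfer_mean h2.
Proof.
move=> l1 l2 le12; apply: ler_lim.
- by apply/cvg_ex; exists (transfer_mean h1); exact: cvg_transfer_mean l1.
- by apply/cvg_ex; exists (transfer_mean h2); exact: cvg_transfer_mean l2.
- by apply: nearW => m; exact: iter_transfer_le l1 l2 le12 unit0.
Qed.

Lemma transfer_mean_dist e L1 L2 h1 h2 : unit_lip L1 h1 -> unit_lip L2 h2 ->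
  (forall t, 0 <= t <= 1 -> `|h1 t - h2 t| <= e) ->
  `|transfer_mean h1 - transfer_mean h2| <= e.
Proof.
move=> l1 l2 le12.
have A c : transfer_mean (fun t => 1 * h2 t + c) = transfer_mean h2 + c.
  by rewrite (transfer_mean_lin _ l2 (unit_lip_cst c)) transfer_mean_cst mul1r.
have lc c := unit_lip_lin 1 l2 (unit_lip_cst c).
have H1 := transfer_mean_le l1 (lc e); have H2 := transfer_mean_le (lc (- e)) l1.
rewrite A in H1; rewrite A in H2.
rewrite ler_distl H1 ?H2 // => t /le12; rewrite ler_norml => /andP[? ?]; lra.
Qed.

Lemma transfer_mean_transfer L h : unit_lip L h ->
  transfer_mean (transfer h) = transfer_mean h.
Proof.
move=> hL; apply: cvg_lim => //.
rewrite (_ : (fun m => _) = (fun m => iter m.+1 transfer h 0)); last first.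
  by apply/funext => m; rewrite iterSr.
have := cvg_transfer_mean hL; by rewrite -(cvg_shiftS (fun m => iter m transfer h 0)).
Qed.

(** * The Moebius kernel and the value of its mean *)

Definition mobius_kernel t s : R := (1 + s) * (1 + t) / (1 + s * t) ^+ 2.
(** Conditional distribution function of the fractional remainder: in state [s] the remainder is
    below [t] with this probability. [mobius_kernel] is its density with respect to
    [dt / (1 + t)]. *)
Definition mobius_cdf t s : R := (1 + s) * t / (1 + s * t).

Lemma ler_norm_div (x y : R) : 1 <= y -> `|x / y| <= `|x|.
Proof.
move=> y1; rewrite normrM ler_piMr // ger0_norm ?invr_ge0 ?invf_le1; lra.
Qed.

Lemma mobius_kernelC t s : mobius_kernel t s = mobius_kernel s t.
Proof. by rewrite /mobius_kernel mulrC (mulrC s) [(1 + s) * _]mulrC mulrC. Qed.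

Lemma mobius_kernel_lip t : 0 <= t <= 1 -> unit_lip 8 (mobius_kernel t).
Proof.
move=> /andP[t0 t1] x y /andP[x0 x1] /andP[y0 y1]; rewrite /mobius_kernel.
have -> : (1 + x) * (1 + t) / (1 + x * t) ^+ 2 - (1 + y) * (1 + t) / (1 + y * t) ^+ 2
  = (1 + t) * (1 - 2 * t - t ^+ 2 * (x + y) - t ^+ 2 * (x * y)) * (x - y) /
     ((1 + x * t) * (1 + y * t)) ^+ 2.
  by field; rewrite !lt0r_neq0 //; nra.
have xt := mulr_ge0 x0 t0; have yt := mulr_ge0 y0 t0.
apply: (le_trans (ler_norm_div _ _)).
  by rewrite expr_ge1 //; move: (x * t) (y * t) xt yt => ? ? ? ?; nra.
rewrite normrM ler_wpM2r // normrM.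
(* On [0, 1] the factor [1 + t] is at most 2 and the polynomial factor lies between -4 and 4. *)
rewrite (_ : 8 = 2 * 4); last by ring.
have t2 : 0 <= t ^+ 2 <= 1 by apply/andP; split; nra.
have xy : 0 <= x * y <= 1 by apply/andP; split; nra.
by rewrite ler_pM // ler_norml; apply/andP; split; nra.
Qed.

Lemma mobius_kernel_bnd t s : 0 <= t <= 1 -> 0 <= s <= 1 ->
  0 <= mobius_kernel t s <= 4.
Proof.
move=> /andP[t0 t1] /andP[s0 s1]; have st := mulr_ge0 s0 t0.
apply/andP; split.
  by apply: divr_ge0; [apply: mulr_ge0; lra|exact: sqr_ge0].
rewrite ler_pdivrMr; last by rewrite exprn_gt0 //; lra.
have : 1 <= (1 + s * t) ^+ 2 by rewrite expr_ge1 //; lra.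
nra.
Qed.

Lemma mobius_cdf_lip t : 0 <= t <= 1 -> unit_lip 1 (mobius_cdf t).
Proof.
move=> /andP[t0 t1] x y /andP[x0 x1] /andP[y0 y1]; rewrite /mobius_cdf.
have -> : (1 + x) * t / (1 + x * t) - (1 + y) * t / (1 + y * t)
  = t * (1 - t) * (x - y) / ((1 + x * t) * (1 + y * t)).
  by field; rewrite !lt0r_neq0 //; nra.
have xt := mulr_ge0 x0 t0; have yt := mulr_ge0 y0 t0.
apply: (le_trans (ler_norm_div _ _)).
  by move: (x * t) (y * t) xt yt => ? ? ? ?; nra.
rewrite normrM ler_wpM2r // ler_norml; apply/andP; split; nra.
Qed.

(* Each term equals [(1 + s) (1 + t) / (b + 1 + s + t)^2], which is symmetric:
   the transfer operator acts in the same way in either variable of the kernel. *)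
Lemma dprob_mobius_kernel b s t : 0 <= s <= 1 -> 0 <= t <= 1 ->
  dprob b s * mobius_kernel t (dmap b s) = dprob b t * mobius_kernel (dmap b t) s.
Proof.
move=> /andP[s0 s1] /andP[t0 t1]; rewrite /dprob /dmap /mobius_kernel.
rewrite -(natr1 b.+1); set v := b.+1%:R.
have v0 : 0 < v by rewrite ltr0n.
field; rewrite !lt0r_neq0 //; nra.
Qed.

Definition kernel_mean t := transfer_mean (mobius_kernel t).

(** The symmetry of the kernel turns its Lipschitz bound in [s] into one in [t], uniform in [s], and
    the mean preserves uniform distances. *)
Lemma kernel_mean_lip : unit_lip 8 kernel_mean.
Proof.
move=> s t s01 t01.
apply: (transfer_mean_dist (mobius_kernel_lip s01) (mobius_kernel_lip t01)).
by move=> u u01; rewrite mobius_kernelC (mobius_kernelC t); exact: mobius_kernel_lip.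
Qed.

(** Applying [U] in [s] does not change the mean, and by [dprob_mobius_kernel] it is the same as
    applying [U] in [t]. What remains is to exchange the mean with the series over digits. *)
Lemma kernel_mean_fixed t : 0 <= t <= 1 -> transfer kernel_mean t = kernel_mean t.
Proof.
move=> t01; have /andP[t0 t1] := t01.
(* Truncation of the series: the mean commutes with this finite sum by linearity, and [dist] bounds
   the rest uniformly in [s], the kernel being at most 4. *)
pose P n s := \sum_(0 <= b < n) dprob b t * mobius_kernel (dmap b t) s.
have PL n : exists2 L, unit_lip L (P n) &
    transfer_mean (P n) = \sum_(0 <= b < n) dprob b t * kernel_mean (dmap b t).
  elim: n => [|n [L lP mP]].
    rewrite big_nil (_ : P 0%N = fun=> 0); last first.
      by apply/funext => s; rewrite /P big_nil.
    by exists 0; [exact: unit_lip_cst|rewrite transfer_mean_cst].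
  have lk := mobius_kernel_lip (dmap01 n t01).
  rewrite (_ : P n.+1 = fun s => dprob n t * mobius_kernel (dmap n t) s + P n s).
    exists (`|dprob n t| * 8 + L); first exact: unit_lip_lin.
    by rewrite (transfer_mean_lin _ lk lP) mP big_nat_recr //= addrC.
  by apply/funext => s; rewrite /P big_nat_recr //= addrC.
have dist n s : 0 <= s <= 1 ->
    `|transfer (mobius_kernel t) s - P n s| <= 4 * dtail n t.
  move=> s01.
  have cP : P m s @[m --> \oo] --> transfer (mobius_kernel t) s.
    have := cvg_transfer (unit_lip_bnd (mobius_kernel_lip t01)) s01.
    rewrite (_ : series _ = (fun m => P m s)) //.
    apply/funext => m; rewrite /series /P /=; apply: eq_bigr => b _.
    exact: dprob_mobius_kernel.
  have cPn : `|P m s - P n s| @[m --> \oo] --> `|transfer (mobius_kernel t) s - P n s|.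
    by apply: cvg_norm; apply: cvgB => //; exact: cvg_cst.
  rewrite -(cvg_lim _ cPn) //; apply: limr_le; first exact: cvgP cPn.
  exists n => // m /= nm; rewrite /P (big_cat_nat (leq0n n) nm) //= addrAC subrr add0r.
  rewrite ger0_norm; last first.
    apply: sumr_ge0 => b _; rewrite mulr_ge0 ?dprob_ge0 //.
    by have /andP[] := mobius_kernel_bnd (dmap01 b t01) s01.
  apply: (@le_trans _ _ (\sum_(n <= b < m) 4 * dprob b t)).
    apply: ler_sum => b _; rewrite mulrC ler_wpM2r ?dprob_ge0 //.
    by have /andP[] := mobius_kernel_bnd (dmap01 b t01) s01.
  rewrite -mulr_sumr ler_wpM2l //.
  have := sum_dprob m t0; rewrite (big_cat_nat (leq0n n) nm) //= sum_dprob //.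
  have := dtail_ge0 m t0; lra.
apply: cvg_lim => //; apply/cvgrPdist_le => e e0.
have /cvgrPdist_le /(_ e e0) : 4 * dtail n t @[n --> \oo] --> (0 : R).
  by rewrite -[X in _ --> X](mulr0 4); apply: cvgMr; exact: cvg_dtail.
apply: filterS => n; rewrite sub0r normrN => /(le_trans (ler_norm _)).
apply: le_trans; have [L lP mP] := PL n; rewrite /series /= -mP.
rewrite /kernel_mean -(transfer_mean_transfer (mobius_kernel_lip t01)).
apply: transfer_mean_dist (dist n) => //; last exact: lP.
exact: transfer_lip (mobius_kernel_lip t01).
Qed.

(** A Lipschitz function fixed by [U] equals all its iterates, so its distance to its mean is at
    most [8 (7/8)^m] for every [m]. *)
Lemma kernel_mean_cst t : 0 <= t <= 1 -> kernel_mean t = kernel_mean 0.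
Proof.
suff H s : 0 <= s <= 1 -> kernel_mean s = transfer_mean kernel_mean.
  by move=> t01; rewrite !H.
move=> s01; apply/eqP; rewrite -subr_eq0 -normr_le0.
have fixm m u : 0 <= u <= 1 -> iter m transfer kernel_mean u = kernel_mean u.
  elim: m u => [//|m IHm] u u01 /=.
  by rewrite (transfer_ext IHm) // kernel_mean_fixed.
have c := cvg_geometric78 8.
rewrite -(cvg_lim _ c) //; apply: limr_ge; first exact: cvgP c.
apply: nearW => m; rewrite -{1}(fixm m s s01).
exact: transfer_mean_bound kernel_mean_lip s01.
Qed.

(** A substitute for the fact that a zero derivative forces constancy: cutting [0, u] into [n + 1]
    equal pieces bounds the total increment by [C u^2 / (n + 1)]. *)
Lemma eq_of_quadratic_modulus (C : R) (D : R -> R) u :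
  (forall s t, 0 <= s <= t -> t <= 1 -> `|D t - D s| <= C * (t - s) ^+ 2) ->
  0 <= u <= 1 -> D u = D 0.
Proof.
move=> hD /andP[u0 u1].
have step n : `|D u - D 0| <= C * harmonic n.
  pose x i : R := u * (i%:R / n.+1%:R).
  have x1 : x n.+1 = u by rewrite /x divff ?mulr1 // pnatr_eq0.
  have x0 : x 0%N = 0 by rewrite /x mul0r mulr0.
  rewrite -x0 -{1}x1 -(telescope_sumr (fun i => D (x i)) (leq0n n.+1)).
  apply: (le_trans (ler_norm_sum _ _ _)).
  apply: (@le_trans _ _ (\sum_(0 <= i < n.+1) C * (u / n.+1%:R) ^+ 2)).
    rewrite big_nat [leRHS]big_nat; apply: ler_sum => i /andP[_ ltin].
    apply: (le_trans (hD _ _ _ _)).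
    - rewrite /x mulr_ge0 ?divr_ge0 //= ler_wpM2l // ler_wpM2r ?invr_ge0 //.
      by rewrite ler_nat.
    - rewrite /x mulr_ile1 ?divr_ge0 // ler_pdivrMr ?ltr0n // mul1r ler_nat.
      exact: ltin.
    rewrite (_ : x i.+1 - x i = u / n.+1%:R) // /x -mulrBr -mulrBl -natr1.
    by rewrite addrAC subrr add0r mul1r.
  rewrite sumr_const_nat subn0 -(mulr_natr (C * _)) /harmonic /=.
  have C0 : 0 <= C.
    have := hD 0 1; rewrite !lexx !ler01 subr0 expr1n mulr1 => H.
    exact: le_trans (normr_ge0 _) (H isT isT).
  rewrite -mulrA ler_wpM2l //.
  have -> : (u / n.+1%:R) ^+ 2 * n.+1%:R = u ^+ 2 * n.+1%:R^-1 :> R.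
    have : 0 < n.+1%:R :> R by []; move: n.+1%:R => v v0.
    by field; rewrite lt0r_neq0.
  rewrite ler_piMl ?invr_ge0 //; nra.
apply/eqP; rewrite -subr_eq0 -normr_le0.
have c : C * harmonic n @[n --> \oo] --> (0 : R).
  by rewrite -[X in _ --> X](mulr0 C); apply: cvgMr; exact: cvg_harmonic.
rewrite -[leRHS](cvg_lim _ c) //; apply: limr_ge; first exact: cvgP c.
by apply: nearW => n; exact: step.
Qed.

(** The mean of [mobius_cdf u] should have derivative [kap / (1 + u)] in [u], where [kap] is the
    constant mean of the kernel. So the difference [D] with [kap * ln (1 + u)] is shown to have only
    second-order increments. *)
Lemma transfer_mean_mobius_cdf t : 0 <= t <= 1 ->
  transfer_mean (mobius_cdf t) = ln (1 + t) / ln 2.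
Proof.
pose kap := kernel_mean 0.
pose D u := transfer_mean (mobius_cdf u) - kap * ln (1 + u).
have kap4 : 0 <= kap <= 4.
  have l := mobius_kernel_lip unit0; apply/andP; split.
    rewrite -(transfer_mean_cst 0); apply: transfer_mean_le l _ => [|s s01].
      exact: unit_lip_cst.
    by have /andP[] := mobius_kernel_bnd unit0 s01.
  rewrite -(transfer_mean_cst 4); apply: (transfer_mean_le l) => [|s s01].
    exact: unit_lip_cst.
  by have /andP[] := mobius_kernel_bnd unit0 s01.
(* In units of [(u - s)^2] the constant is 6 = 2 + 4: 2 for the remainder of [mobius_cdf], and
   [kap <= 4] times 1 for that of the logarithm. *)
have hD s u : 0 <= s <= u -> u <= 1 -> `|D u - D s| <= 6 * (u - s) ^+ 2.
  move=> /andP[s0 su] u1.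
  have s01 : 0 <= s <= 1 by apply/andP; split; lra.
  have u01 : 0 <= u <= 1 by apply/andP; split; lra.
  (* First-order increment of [ln (1 + u)] at [s]; the one of [mobius_cdf] is [y] times the
     kernel. *)
  set y := (u - s) / (1 + s).
  have y0 : 0 <= y by rewrite divr_ge0 //; lra.
  have yle : y <= u - s by rewrite ler_pdivrMr; nra.
  have H1 : `|transfer_mean (mobius_cdf u) -
       (y * kap + transfer_mean (mobius_cdf s))| <= 2 * (u - s) ^+ 2.
    rewrite /kap -(kernel_mean_cst s01).
    rewrite -(transfer_mean_lin _ (mobius_kernel_lip s01) (mobius_cdf_lip s01)).
    apply: (transfer_mean_dist (mobius_cdf_lip u01)) => [|x /andP[x0 x1]].
      exact: unit_lip_lin (mobius_kernel_lip s01) (mobius_cdf_lip s01).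
    have -> : mobius_cdf u x - (y * mobius_kernel s x + mobius_cdf s x) =
       - (1 + x) * x * (u - s) ^+ 2 / ((1 + x * s) ^+ 2 * (1 + x * u)).
      rewrite /y /mobius_cdf /mobius_kernel; field.
      by rewrite !lt0r_neq0 //; nra.
    have xs := mulr_ge0 x0 s0; have xu := mulr_ge0 x0 (le_trans s0 su).
    apply: (le_trans (ler_norm_div _ _)).
      have : 1 <= (1 + x * s) ^+ 2 by rewrite expr_ge1 //; lra.
      nra.
    rewrite normrM [X in _ * X]ger0_norm ?sqr_ge0 // ler_wpM2r ?sqr_ge0 //.
    rewrite ler_norml; apply/andP; split; nra.
  have H2 : `|ln (1 + u) - ln (1 + s) - y| <= (u - s) ^+ 2.
    have e1 : 1 + u = (1 + s) * (1 + y) by rewrite /y; field; lra.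
    rewrite e1 lnM ?posrE; [|lra|lra].
    have l1 : ln (1 + y) <= y by apply: le_ln1Dx; lra.
    (* The lower bound for the logarithm is again [ln (1 + x) <= x], now at [x = - y / (1 + y)],
       where [1 + x] is the inverse of [1 + y]. *)
    have l2 : - (y / (1 + y)) >= - ln (1 + y).
      rewrite -lnV ?posrE; last lra.
      have e3 : (1 + y)^-1 = 1 + - (y / (1 + y)) by field; lra.
      rewrite [in X in X <= _]e3.
      apply: le_ln1Dx; rewrite ltrN2 ltr_pdivrMr; lra.
    have e2 : y / (1 + y) = y - y ^+ 2 / (1 + y) by field; lra.
    have l3 : y ^+ 2 / (1 + y) <= y ^+ 2.
      by rewrite ler_piMr ?sqr_ge0 // invf_le1; lra.
    have l4 : y ^+ 2 <= (u - s) ^+ 2 by rewrite ler_pXn2r // nnegrE; lra.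
    rewrite ler_norml; apply/andP; split; last by have := sqr_ge0 (u - s); lra.
    rewrite e2 in l2; lra.
  have -> : D u - D s = (transfer_mean (mobius_cdf u) -
       (y * kap + transfer_mean (mobius_cdf s))) -
       kap * (ln (1 + u) - ln (1 + s) - y) by rewrite /D; ring.
  have /andP[kap0 kap_le4] := kap4.
  apply: (le_trans (ler_normB _ _)); rewrite normrM (ger0_norm kap0).
  have H3 := ler_pM kap0 (normr_ge0 _) kap_le4 H2; lra.
have DE u : 0 <= u <= 1 -> transfer_mean (mobius_cdf u) = kap * ln (1 + u).
  move=> u01; apply/eqP; rewrite -subr_eq0 -/(D u) (eq_of_quadratic_modulus hD u01).
  rewrite /D addr0 ln1 mulr0 subr0 (_ : mobius_cdf 0 = fun=> 0) ?transfer_mean_cst //.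
  by apply/funext => s; rewrite /mobius_cdf !mulr0 mul0r.
have ln2 : 0 < ln 2 :> R by rewrite ln_gt0 // ltr1n.
(* At [t = 1] the function [mobius_cdf] is identically 1, and this normalises [kap]. *)
have k1 : kap * ln 2 = 1.
  have := DE 1; rewrite lexx ler01 => /(_ isT).
  rewrite (_ : 1 + 1 = 2 :> R) // => <-.
  rewrite -[RHS](transfer_mean_cst 1); apply: transfer_mean_ext => s /andP[s0 _].
  by rewrite /mobius_cdf !mulr1 divff //; lra.
move=> /DE ->; rewrite -[kap](mulfK (lt0r_neq0 ln2)) k1; ring.
Qed.
End TransferOperator.

(** * Digit patterns *)

Section DigitPatterns.
Variable R : realType.
Implicit Types (s t : R) (c : seq (option nat)).

(** Conditional probability, as a function of the state, that the coming digits fit the pattern: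
    [Some b] prescribes digit [b + 1], [None] leaves the digit free. *)
Fixpoint pattern_prob c : R -> R :=
  match c with
  | [::] => fun=> 1
  | None :: c' => transfer (pattern_prob c')
  | Some b :: c' => fun s => dprob b s * pattern_prob c' (dmap b s)
  end.

Lemma dtail_lip b s t : 0 <= s -> 0 <= t -> `|dtail b s - dtail b t| <= `|s - t|.
Proof.
move=> s0 t0; apply: (le_trans (dtailB_le b s0 t0)); rewrite -mulrA ler_piMr //.
rewrite ler_pdivrMr ?exprn_gt0 // mul1r -natrX ler_nat.
by rewrite (leq_trans (leqnSn b)) // leq_pmulr.
Qed.

Lemma dmap_lip b s t : 0 <= s -> 0 <= t -> `|dmap b s - dmap b t| <= `|s - t|.
Proof.
move=> s0 t0; rewrite dmapB //.
apply: (le_trans (ler_norm_div _ _)); last by rewrite distrC.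
by rewrite mulr_ege1 // (le_trans (ler1n R b.+1)) // lerDl.
Qed.

Lemma dprob_le1 b s : 0 <= s -> dprob b s <= 1.
Proof.
move=> s0; have := sum_dprob b.+1 s0; rewrite big_nat_recr //= => H.
have : 0 <= \sum_(0 <= i < b) dprob i s.
  by apply: sumr_ge0 => i _; exact: dprob_ge0.
have := dtail_ge0 b.+1 s0; lra.
Qed.

(** The two claims are proved together because the product rule at a [Some] entry needs the bound by
    1. *)
Lemma pattern_prob_lip c :
  (exists L, unit_lip L (pattern_prob c)) /\
  (forall s, 0 <= s <= 1 -> 0 <= pattern_prob c s <= 1).
Proof.
elim: c => [|[b|] c [[L lL] bL]] /=.
- by split => [|s _]; [exists 0; exact: unit_lip_cst|rewrite ler01 lexx].
- split => [|s s01].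
    (* [dprob] is a difference of two tails, each with Lipschitz constant 1; this gives the 2. *)
    exists (2 + L) => s t s01 t01.
    have /andP[s0 s1] := s01; have /andP[t0 t1] := t01.
    have -> : dprob b s * pattern_prob c (dmap b s) -
        dprob b t * pattern_prob c (dmap b t)
      = (dprob b s - dprob b t) * pattern_prob c (dmap b s) +
        dprob b t * (pattern_prob c (dmap b s) - pattern_prob c (dmap b t)) by ring.
    apply: (le_trans (ler_normD _ _)); rewrite [leRHS]mulrDl lerD // normrM.
      apply: (@le_trans _ _ (`|dprob b s - dprob b t| * 1)).
        have /andP[g0 g1] := bL _ (dmap01 b s01).
        by rewrite ler_wpM2l // ger0_norm.
      rewrite mulr1 !dprobE //.
      have := dtail_lip b s0 t0; have := dtail_lip b.+1 s0 t0.
      rewrite !ler_norml => /andP[? ?] /andP[? ?]; apply/andP; split; lra.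
    rewrite ger0_norm ?dprob_ge0 //.
    apply: (@le_trans _ _ (1 * (L * `|s - t|))); last by rewrite mul1r.
    rewrite ler_pM ?dprob_ge0 ?dprob_le1 //.
    apply: (le_trans (lL _ _ (dmap01 b s01) (dmap01 b t01))).
    by rewrite ler_wpM2l ?dmap_lip //; exact: unit_lip_ge0 lL.
  have /andP[s0 s1] := s01; have /andP[g0 g1] := bL _ (dmap01 b s01).
  by rewrite mulr_ge0 ?dprob_ge0 //= mulr_ile1 ?dprob_ge0 ?dprob_le1.
- split; first by exists (7 / 8 * L); exact: transfer_lip.
  move=> s s01; have lb := unit_lip_bnd lL.
  rewrite -{1}(transfer_cst 0 s01) -(transfer_cst 1 s01).
  by rewrite !transfer_le //; (try exact: unit_bnd_cst) => t /bL /andP[].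
Qed.

Lemma pattern_prob_nones m c :
  pattern_prob (nseq m None ++ c) = iter m (@transfer R) (pattern_prob c).
Proof. by elim: m => //= m ->. Qed.

Lemma dmap_iter01 b k s : 0 <= s <= 1 -> 0 <= iter k (dmap b) s <= 1.
Proof. by move=> s01; elim: k => //= k; exact: dmap01. Qed.

Lemma pattern_prob_run b k c s :
  pattern_prob (nseq k (Some b) ++ c) s =
  pattern_prob (nseq k (Some b)) s * pattern_prob c (iter k (dmap b) s).
Proof.
elim: k s => [|k IHk] s /=; first by rewrite mul1r.
by rewrite IHk mulrA -iterSr.
Qed.

(** After the first run, whatever the state, [d] free digits bring the probability of the second run
    within [(7/8)^d L] of [g]. Averaging over the [i] digits in front preserves this estimate. *)
Lemma run_quasi_independence b k L i d :
  let run := nseq k (Some b) in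
  let g := transfer_mean (pattern_prob run) in
  unit_lip L (pattern_prob run) ->
  `|pattern_prob (nseq i None ++ run) 0 - g| <= (7 / 8) ^+ i * L /\
  `|pattern_prob (nseq i None ++ run ++ nseq d None ++ run) 0 -
    g * pattern_prob (nseq i None ++ run) 0| <= (7 / 8) ^+ d * L.
Proof.
move=> run g hL; have u0 : 0 <= (0 : R) <= 1 by rewrite lexx ler01.
split; first by rewrite pattern_prob_nones; exact: transfer_mean_bound hL u0.
set e := (7 / 8) ^+ d * L; set G := pattern_prob (run ++ nseq d None ++ run).
have [[LG lG] _] := pattern_prob_lip (run ++ nseq d None ++ run).
rewrite -/G in lG.
have e0 : 0 <= e by apply: mulr_ge0; [apply: exprn_ge0; lra|exact: unit_lip_ge0 hL].
have Ge t : 0 <= t <= 1 -> `|G t - g * pattern_prob run t| <= e.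
  move=> t01; rewrite /G pattern_prob_run pattern_prob_nones mulrC -mulrBl normrM.
  have [_ /(_ _ t01) /andP[h0 h1]] := pattern_prob_lip run.
  rewrite (ger0_norm h0) -[leRHS]mulr1 ler_pM //.
  exact: transfer_mean_bound hL (dmap_iter01 b k t01).
rewrite !pattern_prob_nones -/G.
have l2 (c : R) := unit_lip_lin g hL (unit_lip_cst c).
have lin (c : R) : iter i (@transfer R) (fun t => g * pattern_prob run t + c) 0 =
    g * iter i (@transfer R) (pattern_prob run) 0 + c.
  by rewrite (iter_transfer_lin i g hL (unit_lip_cst c) u0) iter_transfer_cst.
have H1 := @iter_transfer_le _ i _ _ _ _ 0 lG (l2 e).
have H2 := @iter_transfer_le _ i _ _ _ _ 0 (l2 (- e)) lG.
rewrite lin in H1; rewrite lin in H2.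
rewrite ler_distl; apply/andP; split; [apply: H2 => //|apply: H1 => //];
  by move=> t /Ge; rewrite ler_norml => /andP[? ?]; lra.
Qed.

(** A run of [k] digits [b + 1] means that the fractional remainder lies between the [k]-th images
    of 0 and 1 under [dmap b]. This map is decreasing, so the order of the end points alternates,
    whence the sign. *)
Lemma pattern_prob_run_cdf b k s : 0 <= s <= 1 ->
  pattern_prob (nseq k (Some b)) s =
  (-1) ^+ k * (mobius_cdf (iter k (dmap b) 1) s - mobius_cdf (iter k (dmap b) 0) s).
Proof.
(* Both sides are the probability that the next digit is [b + 1] and the remainder after it is below
   [t]. *)
have step t x : 0 <= t <= 1 -> 0 <= x <= 1 ->
    dprob b x * mobius_cdf t (dmap b x) =
    mobius_cdf (dmap b 0) x - mobius_cdf (dmap b t) x.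
  move=> /andP[t0 t1] /andP[x0 x1]; rewrite /mobius_cdf /dmap /dprob.
  rewrite -(natr1 b.+1); have : 0 < b.+1%:R :> R by []; move: b.+1%:R => v v0.
  by field; rewrite !lt0r_neq0 //; nra.
have u0 : 0 <= (0 : R) <= 1 by rewrite lexx ler01.
have u1 : 0 <= (1 : R) <= 1 by rewrite lexx ler01.
elim: k s => [|k IHk] s s01 /=.
  rewrite expr0 mul1r /mobius_cdf !mulr0 mul0r subr0 !mulr1 divff //.
  by case/andP: s01 => *; rewrite lt0r_neq0 //; lra.
rewrite IHk ?dmap01 // mulrCA mulrBr !step ?dmap_iter01 // exprS; ring.
Qed.

(** By the previous lemmas the mean is, up to sign, the base-2 logarithm of [(1 + v) / (1 + w)],
    with [v] and [w] the [k]-th images of 1 and 0. A determinant identity for continuants evaluates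
    this quotient. *)
Lemma run_frequency b k :
  transfer_mean (pattern_prob (nseq k (Some b))) =
  `|log2 (1 + (-1) ^+ k / (genfib b.+1 k.+2)%:R ^+ 2 : R)|.
Proof.
have u0 : 0 <= (0 : R) <= 1 by rewrite lexx ler01.
have u1 : 0 <= (1 : R) <= 1 by rewrite lexx ler01.
have v01 := dmap_iter01 b k u1; have w01 := dmap_iter01 b k u0.
set v := iter k _ 1 in v01; set w := iter k _ 0 in w01.
have -> : transfer_mean (pattern_prob (nseq k (Some b))) =
    (-1) ^+ k * (ln (1 + v) / ln 2 - ln (1 + w) / ln 2).
  rewrite -!transfer_mean_mobius_cdf //.
  transitivity (transfer_mean (fun s => (-1) ^+ k * mobius_cdf v s +
       (- (-1) ^+ k * mobius_cdf w s + 0))).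
    apply: transfer_mean_ext => s s01; rewrite pattern_prob_run_cdf //; ring.
  have l1 := mobius_cdf_lip v01; have l2 := mobius_cdf_lip w01.
  have l3 := unit_lip_lin (- (-1) ^+ k) l2 (unit_lip_cst (0 : R)).
  rewrite (transfer_mean_lin _ l1 l3) (transfer_mean_lin _ l2 (unit_lip_cst (0 : R))).
  by rewrite transfer_mean_cst; ring.
set F := fun n => (genfib b.+1 n)%:R : R.
have FS n : F n.+3 = b.+1%:R * F n.+2 + F n.+1 by rewrite /F -natrM -natrD.
(* [y] and [x] are the continuants of [k] and [k - 1] equal entries, so [w = x / y]. The relation
   for [F k.+1] says that it is the sum of the preceding two continuants, with the earlier one
   eliminated by the recurrence. *)
have [x [y [y0 x0 F2 F1 [dt wE vE]]]] : exists x y : R,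
    [/\ 0 < y, 0 <= x, F k.+2 = x + y, F k.+1 = y + (1 - b.+1%:R) * x &
     [/\ F k.+1 * y - F k.+2 * x = (-1) ^+ k, w = x / y & v = F k.+1 / F k.+2]].
  rewrite /v /w; elim: (k) => [|n [x [y [y0 x0 F2 F1 [dt wE vE]]]]].
    have F1 : F 1%N = 1 by []; have F2 : F 2%N = 1 by [].
    exists 0, 1; rewrite F1 F2; split; [by []|by []|by rewrite add0r| |].
      by rewrite mulr0 addr0.
    by split; rewrite /= ?mulr0 ?subr0 ?mul0r ?divr1 ?mulr1.
  have a1 : 0 < b.+1%:R :> R by [].
  have F0 : 0 < F n.+2 by rewrite F2; lra.
  exists y, (b.+1%:R * y + x); rewrite iterS wE iterS vE FS /dmap; split.
  - nra.
  - exact: ltW.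
  - rewrite F2 F1; ring.
  - rewrite F2; ring.
  split.
  - rewrite exprS -dt F2 F1; ring.
  - by field; rewrite !lt0r_neq0 //; nra.
  - have F10 : 0 <= F n.+1 by [].
    by field; rewrite !lt0r_neq0 //; nra.
have F0 : 0 < F k.+2 by rewrite F2; lra.
have v1 : 0 < 1 + v by case/andP: v01 => *; lra.
have w1 : 0 < 1 + w by case/andP: w01 => *; lra.
have e1 : (1 + v) / (1 + w) = 1 + (-1) ^+ k / F k.+2 ^+ 2.
  rewrite wE vE -dt F2; rewrite F2 in F0; field.
  by rewrite !lt0r_neq0 //; lra.
rewrite -e1 /log2 lnM ?posrE ?invr_gt0 // lnV ?posrE // -mulrBl.
have ln20 : 0 < ln 2 :> R by rewrite ln_gt0 // ltr1n.
have F20 : 0 <= (F k.+2 ^+ 2)^-1 by rewrite invr_ge0 sqr_ge0.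
(* The parity of [k] decides whether the quotient is at most or at least 1, hence the sign of its
   logarithm. *)
move: e1; rewrite -signr_odd; case: (odd k); rewrite ?expr0 ?expr1 => e1.
  have vw : ln (1 + v) <= ln (1 + w).
    by rewrite ler_ln ?posrE // -[leRHS]mul1r -ler_pdivrMr // e1; lra.
  rewrite ler0_norm ?mulN1r // pmulr_lle0 ?invr_gt0 //; lra.
have vw : ln (1 + w) <= ln (1 + v).
  by rewrite ler_ln ?posrE // -[leLHS]mul1r -ler_pdivlMr // e1; lra.
rewrite ger0_norm ?mul1r // mulr_ge0 ?invr_ge0 ?(ltW ln20) //; lra.
Qed.
End DigitPatterns.

(** * Continued fraction digits of irrational numbers *)

Section ContinuedFractionDigits.
Variable R : realType.
Implicit Types (x y : R) (a : nat -> int) (n : nat).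

Definition cf_step x : R := (x - (Num.floor x)%:~R)^-1.
Definition complete_quotient n x : R := iter n cf_step x.
Definition gauss_digit x n : int := Num.floor (complete_quotient n x).

Lemma irrational_inv_subz x (z : int) : irrational x -> irrational (x - z%:~R)^-1.
Proof.
move=> ix [q _ qE]; apply: ix; exists (z%:Q + q^-1) => //.
by rewrite rmorphD /= ratr_int fmorphV /= qE invrK addrC subrK.
Qed.

Lemma irrational_frac x : irrational x -> 0 < x - (Num.floor x)%:~R < 1.
Proof.
move=> ix; have /andP[f0 f1] := floor_itv x.
rewrite intrD in f1; rewrite ltrBlDl subr_gt0 f1 andbT lt_neqAle f0 andbT.
by apply/eqP => xE; apply: ix; exists (Num.floor x)%:Q; rewrite ?ratr_int.
Qed.

Lemma irrational_complete_quotient n x :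
  irrational x -> irrational (complete_quotient n x).
Proof. by move=> ix; elim: n => //= n; exact: irrational_inv_subz. Qed.

Lemma complete_quotient_gt1 n x : irrational x -> 1 < complete_quotient n.+1 x.
Proof.
move=> ix; have /andP[f0 f1] := irrational_frac (@irrational_complete_quotient n _ ix).
by rewrite /= /cf_step invf_gt1.
Qed.

Lemma gauss_digitS x : (fun i => gauss_digit x i.+1) = gauss_digit (cf_step x).
Proof. by apply/funext => i; rewrite /gauss_digit /complete_quotient iterSr. Qed.

Lemma gauss_digit_gt0 x n : irrational x -> 0 < gauss_digit x n.+1.
Proof. by move=> ix; rewrite floor_gt0 ltW // complete_quotient_gt1. Qed.

Lemma cf_finite_ge1 a n : (forall i, 0 < a i) -> 1 <= cf_finite R a n.
Proof.
elim: n a => [|n IHn] a ha /=; first by rewrite (ler_int _ 1) -gtz0_ge1 ha.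
apply: (@le_trans _ _ (a 0%N)%:~R); first by rewrite (ler_int _ 1) -gtz0_ge1 ha.
by rewrite lerDl invr_ge0 (le_trans ler01) // IHn.
Qed.

Lemma cf_finite_itv a n : (forall i, 0 < a i.+1) ->
  (a 0%N)%:~R <= cf_finite R a n <= (a 0%N)%:~R + 1.
Proof.
move=> ha; case: n => [|n] /=; first by rewrite lexx lerDl ler01.
have h := cf_finite_ge1 n ha.
by rewrite lerDl lerD2l invr_ge0 invf_le1 ?h ?(le_trans ler01) // (lt_le_trans ltr01).
Qed.

(** One inversion on numbers at least 1 has no contraction factor below 1; two successive levels
    contract by 1/4. *)
Lemma cf_contraction (c u v : R) : 1 <= c -> 1 <= u -> 1 <= v ->
  `|(c + u^-1)^-1 - (c + v^-1)^-1| <= `|u - v| / 4.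
Proof.
move=> c1 u1 v1.
have -> : (c + u^-1)^-1 - (c + v^-1)^-1 = (u - v) / ((c * u + 1) * (c * v + 1)).
  by field; rewrite !lt0r_neq0 //; nra.
have p1 : 2 <= c * u + 1 by nra.
have p2 : 2 <= c * v + 1 by nra.
rewrite normrM ler_wpM2l // normfV ger0_norm; last by nra.
by rewrite lef_pV2 ?posrE; nra.
Qed.

(** Induction by two levels, each pair dividing the error by 4; this is why the cases 0 and 1 are
    both treated directly. *)
Lemma cf_finite_gauss_digit n x : irrational x ->
  `|cf_finite R (gauss_digit x) n - x| <= 2 * 2^-1 ^+ n.
Proof.
have base y : irrational y -> `|(Num.floor y)%:~R - y| <= 1.
  by move=> /irrational_frac; rewrite ler_norml => /andP[? ?]; apply/andP; split; lra.
have xE y : irrational y -> y = (Num.floor y)%:~R + (cf_step y)^-1.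
  by move=> iy; rewrite /cf_step invrK addrC subrK.
elim/ltn_ind: n x => -[|[|n]] IH x ix.
- by rewrite expr0 mulr1 (le_trans (base x ix)) // ler1n.
- rewrite /= -[gauss_digit x 1]/((fun i => gauss_digit x i.+1) 0%N) gauss_digitS.
  rewrite [X in `|_ - X|](xE x ix) opprD addrACA subrr add0r expr1 divff //.
  have s1 := complete_quotient_gt1 0 ix; rewrite /= in s1.
  have g1 : 1 <= (gauss_digit (cf_step x) 0)%:~R :> R.
    by rewrite (ler_int _ 1) -gtz0_ge1 floor_gt0 ltW.
  have inv01 (y : R) : 1 <= y -> 0 <= y^-1 <= 1.
    by move=> y1; apply/andP; split; rewrite ?invr_ge0 ?invf_le1; lra.
  have /andP[? ?] := inv01 _ g1; have /andP[? ?] := inv01 _ (ltW s1).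
  by rewrite ler_norml; apply/andP; split; lra.
have is1 := @irrational_inv_subz _ (Num.floor x) ix; rewrite -/(cf_step x) in is1.
have is2 := @irrational_inv_subz _ (Num.floor (cf_step x)) is1.
rewrite -/(cf_step _) in is2.
rewrite /= -[gauss_digit x 1]/((fun i => gauss_digit x i.+1) 0%N).
rewrite -[fun i => gauss_digit x i.+2]/(fun i => (fun i => gauss_digit x i.+1) i.+1).
rewrite gauss_digitS gauss_digitS [X in `|_ - X|](xE x ix) opprD addrACA subrr add0r.
rewrite [X in `|_ - X^-1|](xE _ is1).
have c1 : 1 <= (gauss_digit (cf_step x) 0)%:~R :> R.
  by rewrite (ler_int _ 1) -gtz0_ge1 -gauss_digitS gauss_digit_gt0.
have u1 : 1 <= cf_finite R (gauss_digit (cf_step (cf_step x))) n.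
  by apply: cf_finite_ge1 => i; rewrite -gauss_digitS gauss_digit_gt0.
have v1 : 1 <= cf_step (cf_step x) by exact: ltW (complete_quotient_gt1 0 is1).
apply: (le_trans (cf_contraction c1 u1 v1)).
by have := IH n (leqnSn n.+1) _ is2; rewrite !exprS; lra.
Qed.

Lemma cf_expansion_gauss_digit x : irrational x -> cf_expansion x (gauss_digit x).
Proof.
move=> ix; split => // [[//|i] _|]; first exact: gauss_digit_gt0.
apply/cvgrPdist_le => e e0.
have /cvgrPdist_le /(_ e e0) : 2 * 2^-1 ^+ n @[n --> \oo] --> (0 : R).
  rewrite -[X in _ --> X](mulr0 2); apply: cvgMr; apply: cvg_expr.
  by rewrite ger0_norm ?invr_ge0 //; lra.
apply: filterS => n; rewrite sub0r normrN distrC => /(le_trans (ler_norm _)).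
by apply: le_trans; exact: cf_finite_gauss_digit.
Qed.

(** The tail converges because inversion is continuous at the nonzero fractional part. Its limit
    lies in [[a 1, a 1 + 1]], and irrationality excludes the upper end, so [a 1] is its floor. *)
Lemma cf_expansion_step x a : irrational x -> cf_expansion x a ->
  cf_expansion (cf_step x) (fun i => a i.+1).
Proof.
move=> ix [a0 apos ca].
have is1 := @irrational_inv_subz _ (Num.floor x) ix; rewrite -/(cf_step x) in is1.
have cs : cf_finite R (fun i => a i.+1) n @[n --> \oo] --> cf_step x.
  rewrite (_ : (fun n => _) =
     (fun n => (cf_finite R a n.+1 - (Num.floor x)%:~R)^-1)); last first.
    by apply/funext => n /=; rewrite a0 addrAC subrr add0r invrK.
  apply: cvgV; first by have /andP[/lt0r_neq0] := irrational_frac ix.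
  apply: cvgB; last exact: cvg_cst.
  by rewrite (cvg_shiftS (cf_finite R a)).
split => //; last by move=> i _; exact: apos.
have itv n := @cf_finite_itv (fun i => a i.+1) n (fun i => apos i.+2 isT).
have l1 : (a 1%N)%:~R <= cf_step x.
  rewrite -(cvg_lim _ cs) //; apply: limr_ge; first exact: cvgP cs.
  by apply: nearW => n; have /andP[] := itv n.
have l2 : cf_step x <= (a 1%N)%:~R + 1.
  rewrite -(cvg_lim _ cs) //; apply: limr_le; first exact: cvgP cs.
  by apply: nearW => n; have /andP[] := itv n.
apply/esym/floor_def; rewrite l1 intrD lt_neqAle l2 andbT /=.
by apply/eqP => E; apply: is1; rewrite E; exists (a 1%N + 1)%:Q;
  rewrite ?ratr_int ?intrD.
Qed.

(** [cf_digit] is a choice among all expansions. The algorithm provides one, and any other agrees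
    with it digit by digit by passing to tails. *)
Lemma cf_digitE x : irrational x -> cf_digit x = gauss_digit x.
Proof.
move=> ix; have : cf_expansion x (cf_digit x).
  exact: (@xgetPex _ _ [set a | cf_expansion x a])
    (ex_intro _ _ (cf_expansion_gauss_digit ix)).
move: (cf_digit x) => a H; apply/funext => n.
elim: n x a ix H => [|n IHn] x a ix xa; first by case: xa.
rewrite (IHn (cf_step x) (fun i => a i.+1)) -?gauss_digitS //.
  exact: irrational_inv_subz.
exact: cf_expansion_step.
Qed.

End ContinuedFractionDigits.

(** * Lebesgue measure of digit patterns *)

Section DigitCylinders.
Variable R : realType.
Implicit Types (x s t : R) (z : int) (w : seq nat) (c d : seq (option nat)).

Local Notation mu := (@lebesgue_measure R).

(** The first entry is compared with digit [m + 1]; for [m = 0] the pattern thus starts just after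
    the integer part. *)
Fixpoint digits_match x (m : nat) c : Prop :=
  if c is o :: c' then
    (if o is Some b then gauss_digit x m.+1 = b.+1%:Z else True) /\
    digits_match x m.+1 c'
  else True.

Definition digit_set z c : set R :=
  [set x | [/\ irrational x, Num.floor x = z & digits_match x 0 c]].

Lemma digits_match_cat x m c d : digits_match x m (c ++ d) <->
  digits_match x m c /\ digits_match x (m + size c) d.
Proof.
elim: c m => [|o c IHc] m /=; first by rewrite addn0; tauto.
by rewrite IHc addnS addSn; tauto.
Qed.

Lemma digits_match_nones x m n : digits_match x m (nseq n None).
Proof. by elim: n m => //= n IHn m; split. Qed.

(* Started at [(1, z)] and at [(0, 1)], this yields the last two numerators and
   denominators of the convergents; an entry [b] of [w] stands for digit [b + 1]. *)
Definition continuants (u : R * R) w : R * R :=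
  foldl (fun u b => (u.2, b.+1%:R * u.2 + u.1)) u w.

Lemma continuants_den w : let q := continuants (0, 1) w in
  0 <= q.1 <= q.2 /\ 0 < q.2.
Proof.
elim/last_ind: w => [|w b]; first by rewrite /= lexx ler01.
rewrite /continuants foldl_rcons -/(continuants (0, 1) w) /=.
case: (continuants _ w) => q1 q2 /= [/andP[h1 h2] h3].
have : 1 <= b.+1%:R :> R by rewrite ler1n.
by move: b.+1%:R => v v1; rewrite (ltW h3) /=; split; nra.
Qed.

(** The determinant is 1 or -1; squaring avoids tracking the sign. *)
Lemma continuants_det z w : let p := continuants (1, z%:~R) w in
  let q := continuants (0, 1) w in (p.1 * q.2 - p.2 * q.1) ^+ 2 = 1.
Proof.
elim/last_ind: w => [|w b]; first by rewrite /= mulr0 mulr1 subr0 expr1n.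
rewrite /continuants !foldl_rcons -/(continuants (0, 1) w) -/(continuants (1, _) w) /=.
by case: (continuants _ w) (continuants _ w) => [p1 p2] [q1 q2] /= <-; ring.
Qed.

(** The number with integer part [z], digits given by [w] and then complete quotient [1 / t]. *)
Definition digit_moebius z w t : R :=
  let p := continuants (1, z%:~R) w in let q := continuants (0, 1) w in
  (p.1 * t + p.2) / (q.1 * t + q.2).

Lemma digit_moebius_rcons z w b t : 0 < t ->
  digit_moebius z (rcons w b) t = digit_moebius z w (b.+1%:R + t)^-1.
Proof.
move=> t0; rewrite /digit_moebius /continuants !foldl_rcons.
rewrite -/(continuants (0, 1) w) -/(continuants (1, _) w).
have := continuants_den w.
case: (continuants _ w) (continuants _ w) => [q1 q2] [p1 p2] /= [/andP[h1 h2] h3].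
have : 0 < b.+1%:R :> R by []; move: b.+1%:R => v v0.
by field; rewrite !lt0r_neq0 //; nra.
Qed.

(** The value of the next complete quotient is part of the claim because the induction reads the
    next digit off it. *)
Lemma digit_set_moebius z w x : irrational x ->
  (digit_set z (map Some w) x -> exists2 t, 0 < t < 1 &
     x = digit_moebius z w t /\ complete_quotient (size w).+1 x = t^-1) /\
  (forall t, 0 < t < 1 -> x = digit_moebius z w t ->
     digit_set z (map Some w) x /\ complete_quotient (size w).+1 x = t^-1).
Proof.
move=> ix; elim/last_ind: w => [|w b [IH1 IH2]].
  rewrite /digit_moebius /=; split.
    move=> [_ xz _]; exists (x - z%:~R); first by rewrite -xz irrational_frac.
    by rewrite mul1r mul0r add0r divr1 subrK /cf_step xz.
  move=> t /andP[t0 t1]; rewrite mul1r mul0r add0r divr1 => xE.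
  have fx : Num.floor x = z by apply: floor_def; rewrite intrD xE; lra.
  by split; [split|rewrite /cf_step fx xE addrK].
rewrite size_rcons map_rcons -cats1; split.
  move=> [_ xz /digits_match_cat[xw]]; rewrite /= add0n size_map => -[xb _].
  have [|t t01 [xE cE]] := IH1; first by split.
  have := irrational_frac (@irrational_complete_quotient _ (size w).+1 _ ix).
  rewrite -[Num.floor _]/(gauss_digit x (size w).+1) xb => fr.
  exists (complete_quotient (size w).+1 x - b.+1%:R) => //.
  split; last first.
    rewrite -[LHS]/(cf_step (complete_quotient (size w).+1 x)) /cf_step.
    by rewrite -/(gauss_digit x _) xb.
  rewrite digit_moebius_rcons; last by case/andP: fr.
  by rewrite addrC subrK cE invrK.
move=> t t01; have /andP[t0 t1] := t01; rewrite digit_moebius_rcons // => xE.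
have b1 : 1 <= b.+1%:R :> R by rewrite ler1n.
have [|[_ xz xw] cE] := IH2 _ _ xE.
  by rewrite invr_gt0 invf_lt1; lra.
rewrite invrK in cE.
have xb : gauss_digit x (size w).+1 = b.+1.
  by apply: floor_def; rewrite cE intrD -pmulrn; lra.
split; last first.
  rewrite -[LHS]/(cf_step (complete_quotient (size w).+1 x)) /cf_step.
  by rewrite -/(gauss_digit x _) xb cE addrAC subrr add0r.
split => //; apply/digits_match_cat; split => //=.
by rewrite add0n size_map.
Qed.

(** * Cylinders as intervals, and their measures *)

Lemma countable_rational : countable (@rational R).
Proof. by apply: sub_countable (card_image_le _ _) _; exact: countableP. Qed.

Lemma rational_measurable : measurable (@rational R).
Proof. by apply: countable_measurable => //; exact: countable_rational. Qed.

Lemma irrational_measurable : measurable (@irrational R).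
Proof. apply: measurableC; exact: rational_measurable. Qed.

Lemma lebesgue_measure_irrational (A : set R) : measurable A ->
  mu (irrational `&` A) = mu A.
Proof.
move=> mA; have mI := measurableI _ _ irrational_measurable mA.
have mQ := measurableI _ _ rational_measurable mA.
rewrite -[in RHS](setTI A) -(setUCl (@rational R)) setIUl measureU0 //.
apply/eqP; rewrite -measure_le0 -(countable_lebesgue_measure0 countable_rational).
by apply: le_measure; rewrite ?inE //; exact: rational_measurable.
Qed.

(** A Moebius map of determinant 1 or -1 is monotone, so the image is the open interval between the
    values at 0 and 1. Their order depends on the sign [e]; multiplying the inequalities by [e]
    treats both signs at once. *)
Lemma digit_moebius_image z w : exists lo hi : R,
  hi - lo = ((continuants (0, 1) w).2 *
             ((continuants (0, 1) w).2 + (continuants (0, 1) w).1))^-1 /\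
  forall x, lo < x < hi <-> exists2 t, 0 < t < 1 & x = digit_moebius z w t.
Proof.
have := continuants_den w; have := continuants_det z w.
rewrite /digit_moebius.
case: (continuants _ w) (continuants _ w) => [q1 q2] [p1 p2] /= det [/andP[h1 h2] h3].
have h4 : 0 < q2 + q1 by lra.
set e := p1 * q2 - p2 * q1 in det *.
have key x : (0 < e * (x * q2 - p2)) && (0 < e * (p1 + p2 - x * (q2 + q1))) <->
    exists2 t, 0 < t < 1 & x = (p1 * t + p2) / (q1 * t + q2).
  split=> [/andP[u0 v0]|[t /andP[t0 t1] xE]].
    set u := e * (x * q2 - p2) in u0; set v := e * (_ - _) in v0.
    have uv : 0 < u + v by lra.
    (* For [x] the image of [t], the quantities [u] and [v] are [t] and [1 - t] over the same
       denominator, so this recovers [t]. *)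
    exists (u / (u + v)).
      by rewrite divr_gt0 //= ltr_pdivrMr // mul1r; lra.
    have dE : q1 * u + q2 * (u + v) = 1 by rewrite -det /u /v /e; ring.
    have nE : p1 * u + p2 * (u + v) = x by rewrite -[RHS]mulr1 -det /u /v /e; ring.
    have -> : p1 * (u / (u + v)) + p2 = x / (u + v).
      by rewrite -nE; field; rewrite lt0r_neq0.
    have -> : q1 * (u / (u + v)) + q2 = 1 / (u + v).
      by rewrite -dE; field; rewrite lt0r_neq0.
    by field; rewrite lt0r_neq0.
  have dt : 0 < q1 * t + q2 by nra.
  have -> : e * (x * q2 - p2) = t / (q1 * t + q2).
    transitivity (t * e ^+ 2 / (q1 * t + q2)); last by rewrite det mulr1.
    by rewrite xE /e; field; rewrite lt0r_neq0.
  have -> : e * (p1 + p2 - x * (q2 + q1)) = (1 - t) / (q1 * t + q2).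
    transitivity ((1 - t) * e ^+ 2 / (q1 * t + q2)); last by rewrite det mulr1.
    by rewrite xE /e; field; rewrite lt0r_neq0.
  by rewrite !divr_gt0 //; lra.
have itv (x y q : R) : 0 < q -> (x < y / q) = (x * q < y).
  by move=> q0; rewrite ltr_pdivlMr.
have itv' (x y q : R) : 0 < q -> (y / q < x) = (y < x * q).
  by move=> q0; rewrite ltr_pdivrMr.
have lenE : (p1 + p2) / (q2 + q1) - p2 / q2 = e * (q2 * (q2 + q1))^-1.
  by rewrite /e; field; rewrite !lt0r_neq0.
have /orP[/eqP D|/eqP D] : (e == 1) || (e == -1) by rewrite -sqrf_eq1 det.
  exists (p2 / q2), ((p1 + p2) / (q2 + q1)); split; first by rewrite lenE D mul1r.
  move=> x; rewrite -key D !mul1r !subr_gt0 itv // itv' //.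
exists ((p1 + p2) / (q2 + q1)), (p2 / q2); split.
  by rewrite -opprB lenE D mulN1r opprK.
by move=> x; rewrite -key D !mulN1r !oppr_gt0 !subr_lt0 itv // itv' // andbC.
Qed.

Lemma digit_set_cylinder z w :
  measurable (digit_set z (map Some w)) /\
  mu (digit_set z (map Some w)) =
    (((continuants (0, 1) w).2 *
      ((continuants (0, 1) w).2 + (continuants (0, 1) w).1))^-1)%:E.
Proof.
have [lo [hi [lenE imE]]] := digit_moebius_image z w.
have -> : digit_set z (map Some w) = irrational `&` [set` `]lo, hi[].
  apply/seteqP; split => x.
    move=> xd; have ix : irrational x by case: xd.
    have [/(_ xd) [t t01 [xE _]] _] := digit_set_moebius z w ix.
    by split => //=; rewrite in_itv /=; apply/imE; exists t.
  move=> [ix /=]; rewrite in_itv /= => /imE [t t01 xE].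
  by have [_ /(_ t t01 xE) []] := digit_set_moebius z w ix.
split; first by apply: measurableI => //; exact: irrational_measurable.
have [/andP[h1 h2] h3] := continuants_den w.
have lohi : lo < hi.
  by rewrite -subr_gt0 lenE invr_gt0 mulr_gt0 // ltr_pwDl.
by rewrite lebesgue_measure_irrational // lebesgue_measure_itv /= lte_fin lohi
  -EFinB lenE.
Qed.

Definition state w : R := foldl (fun s b => dmap b s) 0 w.

Lemma stateE w : state w = (continuants (0, 1) w).1 / (continuants (0, 1) w).2.
Proof.
elim/last_ind: w => [|w b IHw]; first by rewrite /= mul0r.
have := continuants_den w.
rewrite /state /continuants !foldl_rcons -/(continuants (0, 1) w) -/(state w) IHw /=.
case: (continuants _ w) => [q1 q2] /= [/andP[h1 h2] h3]; rewrite /dmap.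
have : 0 < b.+1%:R :> R by []; move: b.+1%:R => v v0.
by field; rewrite !lt0r_neq0 //; nra.
Qed.

Lemma state01 w : 0 <= state w <= 1.
Proof.
have [/andP[h1 h2] h3] := continuants_den w.
by rewrite stateE divr_ge0 ?(ltW h3) //= ler_pdivrMr // mul1r.
Qed.

(** The Markov property: the ratio of the two cylinder lengths depends on the prefix only through
    the quotient of its last two denominators, which is the state. *)
Lemma digit_set_rcons z w b :
  mu (digit_set z (map Some (rcons w b))) =
  (mu (digit_set z (map Some w)) * (dprob b (state w))%:E)%E.
Proof.
have [_ ->] := digit_set_cylinder z w; have [_ ->] := digit_set_cylinder z (rcons w b).
rewrite stateE -EFinM; congr _%:E.
have := continuants_den w.
rewrite /continuants !foldl_rcons -/(continuants (0, 1) w) /dprob /=.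
case: (continuants _ w) => [q1 q2] /= [/andP[h1 h2] h3].
rewrite -(natr1 b.+1); have : 0 < b.+1%:R :> R by []; move: b.+1%:R => v v0.
by field; rewrite !lt0r_neq0 //; nra.
Qed.

(** Induction on the pattern for all prefixes: a prescribed digit moves to the prefix, and a free
    digit splits the set into countably many disjoint pieces whose measures sum to the series
    defining [transfer]. *)
Lemma digit_set_prefix z w c :
  measurable (digit_set z (map Some w ++ c)) /\
  mu (digit_set z (map Some w ++ c)) =
  (mu (digit_set z (map Some w)) * (pattern_prob c (state w))%:E)%E.
Proof.
elim: c w => [|[b|] c IHc] w.
- by rewrite cats0 mule1; split => //; have [] := digit_set_cylinder z w.
- rewrite -cat_rcons -map_rcons; have [m ->] := IHc (rcons w b); split => //.
  by rewrite digit_set_rcons -muleA -EFinM /state foldl_rcons.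
pose F b := digit_set z (map Some w ++ Some b :: c).
have FE : digit_set z (map Some w ++ None :: c) = \bigcup_b F b.
  apply/seteqP; split => x.
    move=> [ix xz /digits_match_cat [xw]]; rewrite /= add0n size_map => -[_ xc].
    have g0 := @gauss_digit_gt0 _ _ (size w) ix.
    exists `|gauss_digit x (size w).+1|.-1%N => //; split => //.
    apply/digits_match_cat; split => //=; rewrite add0n size_map; split => //.
    by rewrite prednK ?absz_gt0 ?gt_eqF // gtz0_abs.
  move=> [b _ [ix xz /digits_match_cat [xw]]]; rewrite /= => -[_ xc].
  by split => //; apply/digits_match_cat.
have IHF b : measurable (F b) /\ mu (F b) = 
    (mu (digit_set z (map Some w)) *
      (dprob b (state w) * pattern_prob c (dmap b (state w)))%:E)%E.
  rewrite /F -cat_rcons -map_rcons; have [m ->] := IHc (rcons w b); split => //.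
  by rewrite digit_set_rcons -muleA -EFinM /state foldl_rcons.
rewrite FE; split; first by apply: bigcup_measurable => b _; case: (IHF b).
rewrite measure_bigcup //=; last 2 first.
- by move=> b _; case: (IHF b).
- move=> b b' _ _ [x [[_ _ /digits_match_cat [_ /= [xb _]]]
    [_ _ /digits_match_cat [_ /= [xb' _]]]]].
  by move: xb; rewrite xb' => -[->].
have [_ muE] := digit_set_cylinder z w.
under eq_eseriesr do rewrite (IHF _).2 muE -EFinM.
set l := (_^-1).
have [[L lL] _] := pattern_prob_lip R c.
have cv := cvg_transfer (unit_lip_bnd lL) (state01 w).
rewrite muE -EFinM; apply: cvg_lim => //.
rewrite (_ : (fun n => _) = (fun n => (l * series (fun b => dprob b (state w) *
   pattern_prob c (dmap b (state w))) n)%:E)); last first.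
  apply/funext => n; rewrite /series /= mulr_sumr -sumEFin.
  by apply: eq_bigl => b; rewrite in_setT.
by apply: cvg_EFin; [exact: nearW|apply: cvgMr]; exact: cv.
Qed.

Lemma digit_set_measure z c :
  measurable (digit_set z c) /\ mu (digit_set z c) = (pattern_prob c 0)%:E.
Proof.
have [m ->] := digit_set_prefix z [::] c; split => //.
by have [_ ->] := digit_set_cylinder z [::]; rewrite /= addr0 mulr1 invr1 mul1e.
Qed.

End DigitCylinders.

(** * Strong law of large numbers for weakly correlated sets *)

(** Used with [M^2 <= n < (M + 1)^2]: then [n - M^2] is of order [M], and both averages move by at
    most its ratio to [n]. *)
Lemma square_average_dist (R : realFieldType) (M n T U : R) :
  1 <= M -> n <= M ^+ 2 + 3 * M -> M ^+ 2 <= n -> 0 <= T <= M ^+ 2 ->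
  0 <= U - T <= n - M ^+ 2 -> `|n^-1 * U - (M ^+ 2)^-1 * T| <= 3 * M^-1.
Proof.
move=> M1 nM N0 /andP[T0 T1] /andP[d0 d1].
have M2 : 0 < M ^+ 2 by rewrite exprn_gt0 //; lra.
have n0 : 0 < n by lra.
have -> : n^-1 * U - (M ^+ 2)^-1 * T =
   ((U - T) * M ^+ 2 - T * (n - M ^+ 2)) / (n * M ^+ 2).
  by field; rewrite !lt0r_neq0 //; lra.
rewrite normrM normfV (ger0_norm (ltW (mulr_gt0 n0 M2))).
have e1 : `|(U - T) * M ^+ 2 - T * (n - M ^+ 2)| <= (n - M ^+ 2) * M ^+ 2.
  have a1 : (U - T) * M ^+ 2 <= (n - M ^+ 2) * M ^+ 2 by rewrite ler_wpM2r // ltW.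
  have a2 : T * (n - M ^+ 2) <= M ^+ 2 * (n - M ^+ 2) by rewrite ler_wpM2r; lra.
  have a3 : 0 <= (U - T) * M ^+ 2 by rewrite mulr_ge0 // ltW.
  have a4 : 0 <= T * (n - M ^+ 2) by rewrite mulr_ge0 //; lra.
  rewrite (mulrC (M ^+ 2)) in a2.
  by rewrite ler_norml; apply/andP; split; lra.
rewrite ler_pdivrMr; last exact: mulr_gt0.
apply: (le_trans e1).
rewrite [leRHS]mulrA ler_wpM2r ?(ltW M2) //.
apply: (@le_trans _ _ (3 * M)); first lra.
have -> : 3 * M = 3 * M^-1 * M ^+ 2 by field; rewrite lt0r_neq0; lra.
by rewrite ler_wpM2l // mulr_ge0 // invr_ge0; lra.
Qed.

(** Between consecutive squares the averages change by at most [3 / (m + 1)], since the increments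
    of [S] lie in [0, 1]. *)
Lemma cvg_average_of_squares (R : realType) (S : nat -> R) (g : R) :
  S 0%N = 0 -> (forall n, S n <= S n.+1 <= S n + 1) ->
  (((m.+1 ^ 2)%N%:R)^-1 * S (m.+1 ^ 2)%N @[m --> \oo] --> g) ->
  n%:R^-1 * S n @[n --> \oo] --> g.
Proof.
move=> S0 Sinc Sg.
have Sdist N n : (N <= n)%N -> 0 <= S n - S N <= n%:R - N%:R.
  move=> /subnK <-; elim: (n - N)%N => [|i /andP[h1 h2]].
    by rewrite add0n !subrr lexx.
  by have /andP[h3 h4] := Sinc (i + N)%N; rewrite addSn -natr1; apply/andP; split; lra.
have Sge N : 0 <= S N <= N%:R by have := Sdist 0%N N isT; rewrite S0 !subr0.
have sqrtn n : exists m, (m ^ 2 <= n < m.+1 ^ 2)%N.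
  elim: n => [|n [m /andP[h1 h2]]]; first by exists 0%N.
  have [h|h] := ltnP n.+1 (m.+1 ^ 2); first by exists m; rewrite (leq_trans h1).
  exists m.+1; rewrite h (leq_ltn_trans h2) // ltn_sqr //.
have close m n : (m.+1 ^ 2 <= n < m.+2 ^ 2)%N ->
    `|n%:R^-1 * S n - ((m.+1 ^ 2)%N%:R)^-1 * S (m.+1 ^ 2)%N| <= 3 * m.+1%:R^-1.
  move=> /andP[h1 h2]; have /andP[d0 d1] := Sdist _ _ h1.
  have := Sge (m.+1 ^ 2)%N.
  move: d0 d1; set T := S (m.+1 ^ 2)%N; move: (S n) => Sn d0 d1 /andP[T0 T1].
  have M1 : 1 <= m.+1%:R :> R by rewrite ler1n.
  have nM : n%:R <= m.+1%:R ^+ 2 + 3 * m.+1%:R :> R.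
    rewrite -natrX -natrM -natrD ler_nat; move: h2; rewrite !expnS !expn0; lia.
  have N0 : m.+1%:R ^+ 2 <= n%:R :> R by rewrite -natrX ler_nat.
  rewrite natrX in T1 d1; rewrite natrX.
  by apply: square_average_dist; rewrite ?T0 ?d0.
apply/cvgrPdist_le => e e0.
have e2 : 0 < e / 2 by rewrite divr_gt0.
have h3 : 3 * harmonic m @[m --> \oo] --> (0 : R).
  by rewrite -[X in _ --> X](mulr0 3); apply: cvgMr; exact: cvg_harmonic.
have /cvgrPdist_le /(_ _ e2) [M1 _ HM1] := Sg.
have /cvgrPdist_le /(_ _ e2) [M2 _ HM2] := h3.
exists ((maxn M1 M2).+1 ^ 2)%N => // n /= hn.
have [[|m] mn] := sqrtn n.
  have := leq_ltn_trans hn (andP mn).2; rewrite ltn_sqr.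
  by rewrite ltnS leqn0.
have hm : (maxn M1 M2 <= m)%N.
  by have := leq_ltn_trans hn (andP mn).2; rewrite ltn_sqr !ltnS.
have c3 := HM1 m (leq_trans (leq_maxl _ _) hm).
have c2 := HM2 m (leq_trans (leq_maxr _ _) hm).
have c1 := close m n mn; rewrite distrC in c1.
have c4 := ler_norm (3 * harmonic m : R).
rewrite /= sub0r normrN in c2; rewrite /= in c3; rewrite /harmonic /= in c2 c4.
rewrite -(subrKA (((m.+1 ^ 2)%N%:R)^-1 * S (m.+1 ^ 2)%N)).
rewrite (le_trans (ler_normD _ _)) // (splitr e).
by rewrite lerD // (le_trans c1) // (le_trans c4).
Qed.

Lemma sum_inv_sqr_le (R : realFieldType) n :
  \sum_(0 <= m < n) (m.+1%:R ^+ 2)^-1 <= 2 :> R.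
Proof.
suff H : \sum_(0 <= m < n.+1) (m.+1%:R ^+ 2)^-1 <= 2 - n.+1%:R^-1 :> R.
  apply: (@le_trans _ _ (\sum_(0 <= m < n.+1) (m.+1%:R ^+ 2)^-1)).
    by rewrite [leRHS]big_nat_recr //= lerDl invr_ge0 sqr_ge0.
  by apply: (le_trans H); rewrite gerBl.
elim: n => [|n IHn]; first by rewrite big_nat1 expr1n invr1; lra.
rewrite big_nat_recr //=; apply: (le_trans (lerD IHn (lexx _))).
have : 0 < n.+1%:R :> R by []; rewrite -(natr1 n.+1); move: n.+1%:R => v v0.
have -> : 2 - v^-1 + ((v + 1) ^+ 2)^-1 = 2 - (v + 1)^-1 - (v * (v + 1) ^+ 2)^-1.
  by field; rewrite !lt0r_neq0 //; lra.
rewrite gerBl invr_ge0 mulr_ge0 ?sqr_ge0 //; exact: ltW.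
Qed.

(* If the centred second moments [V n] of the partial sums grow linearly, then
   [(S n / n - g)^2] is summable almost everywhere along [n = m^2]. *)
Lemma ae_cvg_average (d : measure_display) (T : measurableType d) (R : realType)
    (mu : {measure set T -> \bar R}) (D : set T) (E : nat -> set T)
    (r : nat -> nat -> R) (g C : R) :
  measurable D -> mu D = 1%E -> (forall i, measurable (E i)) ->
  (forall i, E i `<=` D) -> (forall i j, mu (E i `&` E j) = (r i j)%:E) ->
  0 <= g ->
  (forall n, \sum_(i < n) \sum_(j < n) (r i j - g * r i i - g * r j j + g ^+ 2)
     <= C * n%:R) ->
  {ae mu, forall x, D x -> n%:R^-1 * (\sum_(i < n) \1_(E i) x) @[n --> \oo] --> g}.
Proof.
move=> mD muD mE ED rE g0 VC.
pose S n x : R := \sum_(i < n) \1_(E i) x.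
pose f n x : R := (S n x - n%:R * g) ^+ 2.
have mS n : measurable_fun D (S n).
  by apply: measurable_sum => i; exact: measurable_indic.
have mf n : measurable_fun D (f n).
  by apply: measurable_funX; apply: measurable_funB => //; exact: measurable_cst.
have S0 n x : 0 <= S n x by apply: sumr_ge0 => i _; rewrite indicE.
have intS n : (\int[mu]_(x in D) (S n x)%:E)%E = (\sum_(i < n) r i i)%:E.
  under eq_integral do rewrite -sumEFin.
  rewrite ge0_integral_sum //.
    rewrite -sumEFin; apply: eq_bigr => i _; rewrite integral_indic // -rE setIid.
    by congr (mu _); apply/setIidl; exact: ED.
  by move=> i; apply/measurable_EFinP; exact: measurable_indic.
have intS2 n : (\int[mu]_(x in D) (S n x ^+ 2)%:E)%E =
    (\sum_(i < n) \sum_(j < n) r i j)%:E.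
  have E2 x : (S n x ^+ 2)%:E =
      (\sum_(i < n) \sum_(j < n) (\1_(E i `&` E j) x)%:E)%E.
    rewrite expr2 /S mulr_suml -sumEFin; apply: eq_bigr => i _.
    by rewrite mulr_sumr -sumEFin; apply: eq_bigr => j _; rewrite indicI.
  under eq_integral do rewrite E2.
  have mI i j : measurable (E i `&` E j) by exact: measurableI.
  rewrite ge0_integral_sum //; last 2 first.
  - move=> i; apply: emeasurable_sum => j; apply/measurable_EFinP.
    exact: measurable_indic.
  - by move=> i x _; apply: sume_ge0 => j _; rewrite lee_fin indicE.
  rewrite -sumEFin; apply: eq_bigr => i _.
  rewrite ge0_integral_sum //; last first.
    by move=> j; apply/measurable_EFinP; exact: measurable_indic.
  rewrite -sumEFin; apply: eq_bigr => j _; rewrite integral_indic // -rE.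
  by congr (mu _); apply/setIidl => x [/ED].
have intf n : (\int[mu]_(x in D) (f n x)%:E <= (C * n%:R)%:E)%E.
  (* The cross term of the square is moved to the left, so that only integrals of nonnegative
     functions are added. *)
  have key : (\int[mu]_(x in D) (f n x)%:E + (2 * n%:R * g * \sum_(i < n) r i i)%:E =
      (\sum_(i < n) \sum_(j < n) r i j + (n%:R * g) ^+ 2)%:E)%E.
    rewrite (EFinM _ (\sum_(i < n) r i i)) -intS -ge0_integralZl_EFin //; last 3 first.
    - by move=> x _; rewrite lee_fin.
    - exact/measurable_EFinP.
    - by rewrite !mulr_ge0.
    rewrite -ge0_integralD //; last 4 first.
    - by move=> x _; rewrite lee_fin sqr_ge0.
    - exact/measurable_EFinP.
    - by move=> x _; rewrite -EFinM lee_fin !mulr_ge0.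
    - by apply: measurable_funeM; exact/measurable_EFinP.
    under eq_integral => x _.
      rewrite -EFinM -EFinD.
      rewrite (_ : f n x + 2 * n%:R * g * S n x = S n x ^+ 2 + (n%:R * g) ^+ 2);
        last by rewrite /f; ring.
      rewrite EFinD; over.
    rewrite ge0_integralD //; last 3 first.
    - by move=> x _; rewrite lee_fin sqr_ge0.
    - by apply/measurable_EFinP; exact: measurable_funX.
    - by move=> x _; rewrite lee_fin sqr_ge0.
    by rewrite intS2 integral_cst // muD mule1.
  have -> : (\int[mu]_(x in D) (f n x)%:E = (\sum_(i < n) \sum_(j < n)
      (r i j - g * r i i - g * r j j + g ^+ 2))%:E)%E.
    move/(congr1 (fun e => (e - (2 * n%:R * g * \sum_(i < n) r i i)%:E)%E)): key.
    rewrite addeK // => ->; rewrite -EFinB; congr (_%:E).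
    set A := \sum_(i < n) r i i.
    have row i : \sum_(j < n) (r i j - g * r i i - g * r j j + g ^+ 2) =
        \sum_(j < n) r i j - n%:R * (g * r i i) - g * A + n%:R * g ^+ 2.
      rewrite big_split /= !sumrB !sumr_const card_ord -mulr_sumr.
      by rewrite -(mulr_natl (g * r i i)) -(mulr_natl (g ^+ 2)).
    under [RHS]eq_bigr do rewrite row.
    rewrite big_split /= !sumrB !sumr_const card_ord.
    rewrite (_ : \sum_(i < n) n%:R * (g * r i i) = n%:R * (g * A)); last first.
      by rewrite !mulr_sumr.
    by rewrite -(mulr_natl (g * A)) -(mulr_natl (n%:R * g ^+ 2)); ring.
  by rewrite lee_fin.
have C0 : 0 <= C.
  rewrite -lee_fin -[C]mulr1; apply: le_trans (intf 1%N).
  by apply: integral_ge0 => x _; rewrite lee_fin sqr_ge0.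
(* Squared deviation of the average at [(m + 1)^2]. Its integral is at most [C / (m + 1)^2], so the
   series of the [h m] has finite integral and converges almost everywhere. *)
pose h m x : R := ((m.+1 ^ 2)%N%:R ^+ 2)^-1 * f (m.+1 ^ 2)%N x.
have h0 m x : 0 <= h m x by rewrite mulr_ge0 ?sqr_ge0 // invr_ge0 sqr_ge0.
have mh m : measurable_fun D (fun x => (h m x)%:E).
  by apply/measurable_EFinP; apply: measurable_funM => //; exact: measurable_cst.
have inth m : (\int[mu]_(x in D) (h m x)%:E <= (C * (m.+1%:R ^+ 2)^-1)%:E)%E.
  under eq_integral do rewrite EFinM.
  rewrite ge0_integralZl_EFin //; last 2 first.
  - by move=> x _; rewrite lee_fin sqr_ge0.
  - exact/measurable_EFinP.
  apply: (@le_trans _ _ (((m.+1 ^ 2)%N%:R ^+ 2)^-1%:E * (C * (m.+1 ^ 2)%N%:R)%:E)%E).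
    by rewrite lee_wpmul2l ?lee_fin ?invr_ge0 ?sqr_ge0.
  rewrite -EFinM lee_fin natrX mulrCA ler_wpM2l //.
  have : 0 < m.+1%:R :> R by []; move: m.+1%:R => v v0.
  by rewrite (_ : _ * _ = (v ^+ 2)^-1) //; field; rewrite lt0r_neq0.
have aefin : {ae mu, forall x, D x -> (\sum_(0 <= m <oo) (h m x)%:E)%E \is a fin_num}.
  apply: integrable_ae => //; apply/integrableP; split.
    by apply: ge0_emeasurable_sum => // m x _ _; rewrite lee_fin.
  under eq_integral => x _.
    rewrite gee0_abs; last by apply: nneseries_ge0 => m _ _; rewrite lee_fin.
    over.
  rewrite integral_nneseries //; last by move=> m x _; rewrite lee_fin.
  apply: (@le_lt_trans _ _ (C * 2)%:E); last by rewrite ltry.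
  apply: lime_le.
    by apply: is_cvg_nneseries => m _ _; apply: integral_ge0 => x _; rewrite lee_fin.
  apply: nearW => n.
  apply: (@le_trans _ _ (\sum_(0 <= m < n) (C * (m.+1%:R ^+ 2)^-1)%:E)%E).
    by apply: lee_sum => m _; exact: inth.
  by rewrite sumEFin lee_fin -mulr_sumr ler_wpM2l // sum_inv_sqr_le.
apply: filterS aefin => x xfin Dx; have {}xfin := xfin Dx.
apply: (@cvg_average_of_squares _ (fun n => S n x)).
- by rewrite /S big_ord0.
- move=> n; rewrite /S big_ord_recr /= lerDl lerD2l indicE.
  by case: (_ \in _); rewrite ?ler01 ?lexx.
have hcv : cvgn (series (fun m => h m x)).
  apply: nondecreasing_is_cvgn; first by apply: nondecreasing_series => m _ _; exact: h0.
  exists (fine (\sum_(0 <= m <oo) (h m x)%:E)%E) => _ [n _ <-].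
  rewrite -lee_fin fineK // /series /= -sumEFin.
  by apply: nneseries_lim_ge => m _ _; rewrite lee_fin.
have /cvgrPdist_le hc := cvg_series_cvg_0 hcv.
apply/cvgrPdist_le => e e0.
have e2 : 0 < e ^+ 2 by rewrite exprn_gt0.
apply: filterS (hc _ e2) => m; rewrite sub0r normrN ger0_norm //.
have -> : h m x = (g - ((m.+1 ^ 2)%N%:R)^-1 * S (m.+1 ^ 2)%N x) ^+ 2.
  rewrite /h /f; have : 0 < (m.+1 ^ 2)%N%:R :> R by rewrite ltr0n expn_gt0.
  by move: (_ ^ 2)%N%:R => v v0; field; rewrite lt0r_neq0.
by rewrite -real_normK ?num_real // ler_pXn2r ?nnegrE // ltW.
Qed.

(** * Frequency of runs *)

Section RunFrequency.
Variable R : realType.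
Implicit Types (x : R) (z : int) (b k i j n : nat).

Local Notation mu := (@lebesgue_measure R).

(** The powers of 7/8 with positive exponent sum to at most 7; both sides of the diagonal and the
    diagonal itself give 15 = 2 * 7 + 1. *)
Lemma sum_sym_geometric_le (c : nat -> nat -> R) (K : R) n :
  0 <= K -> (forall i j, c i j = c j i) ->
  (forall i j, (i <= j)%N -> c i j <= K * (7 / 8) ^+ (j - i)) ->
  \sum_(i < n) \sum_(j < n) c i j <= 15 * K * n%:R.
Proof.
move=> K0 cC cK.
have geo m : \sum_(i < m) (7 / 8) ^+ (m - i) <= 7 :> R.
  elim: m => [|m IHm]; first by rewrite big_ord0.
  rewrite big_ord_recr /= subSnn expr1.
  under eq_bigr => i _ do rewrite subSn ?(ltnW (ltn_ord i)) // exprS.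
  rewrite -mulr_sumr; lra.
have row m : \sum_(i < m) c i m <= 7 * K.
  apply: (@le_trans _ _ (\sum_(i < m) K * (7 / 8) ^+ (m - i))).
    by apply: ler_sum => i _; exact/cK/ltnW.
  by rewrite -mulr_sumr mulrC ler_wpM2r.
elim: n => [|n IHn]; first by rewrite big_ord0 mulr0.
rewrite big_ord_recr /=; under eq_bigr do rewrite big_ord_recr /=.
rewrite big_split /= big_ord_recr /=.
under [X in _ + _ + (X + _)]eq_bigr do rewrite cC.
have := row n; have := cK n n (leqnn n); rewrite subnn expr0 -(natr1 n) mulrDr; lra.
Qed.

Lemma digits_match_run x m k b :
  digits_match x m (nseq k (Some b)) <->
  forall j, (j < k)%N -> gauss_digit x (m + j.+1) = b.+1%:Z.
Proof.
elim: k m => [|k IHk] m /=; first by split.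
rewrite IHk; split=> [[h1 h2] [|j] jk|H].
- by rewrite addn1.
- by rewrite addnS -addSn h2.
- by split=> [|j jk]; [rewrite -addn1 H|rewrite addSn -addnS H].
Qed.

Lemma run_setP z b k i x : digit_set z (nseq i None ++ nseq k (Some b)) x <->
  [/\ irrational x, Num.floor x = z & digits_match x i (nseq k (Some b))].
Proof.
rewrite /digit_set /=; split.
  by move=> [ix xz /digits_match_cat [_]]; rewrite add0n size_nseq.
move=> [ix xz xm]; split => //; apply/digits_match_cat; split.
  exact: digits_match_nones.
by rewrite add0n size_nseq.
Qed.

Lemma run_setI z b k i d :
  digit_set (R := R) z (nseq i None ++ nseq k (Some b)) `&`
  digit_set z (nseq (i + k + d) None ++ nseq k (Some b)) =
  digit_set z (nseq i None ++ nseq k (Some b) ++ nseq d None ++ nseq k (Some b)).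
Proof.
apply/seteqP; split => x.
  move=> [/run_setP [ix xz x1] /run_setP [_ _ x2]]; split => //.
  apply/digits_match_cat; split; first exact: digits_match_nones.
  apply/digits_match_cat; rewrite add0n !size_nseq; split => //.
  apply/digits_match_cat; rewrite !size_nseq; split => //.
  exact: digits_match_nones.
move=> [ix xz /digits_match_cat[_ /digits_match_cat[x1 /digits_match_cat[_ x2]]]].
by rewrite add0n !size_nseq in x1 x2; split; apply/run_setP.
Qed.

(** Covariances about [g]. If the two windows of length [k] are disjoint, [run_quasi_independence]
    applies to the gap between them. If they overlap, then [j - i <= k], and dividing by [(7/8)^k]
    in the constant absorbs the trivial bound 2. *)
Lemma run_covariance_le z b k : exists2 C : R, 0 <= C &
  let E i := digit_set z (nseq i.+1 None ++ nseq k (Some b)) in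
  let r i j := fine (mu (E i `&` E j)) in
  let g := transfer_mean (@pattern_prob R (nseq k (Some b))) in
  [/\ (forall i j, mu (E i `&` E j) = (r i j)%:E), 0 <= g &
   forall i j, (i <= j)%N ->
     r i j - g * r i i - g * r j j + g ^+ 2 <= C * (7 / 8) ^+ (j - i)].
Proof.
set run := nseq k (Some b).
have [[L hL] h01] := pattern_prob_lip R run.
have L0 := unit_lip_ge0 hL.
set q : R := 7 / 8; have q0 : 0 < q by rewrite /q; lra.
have q1 : q <= 1 by rewrite /q; lra.
have qk : 0 < q ^+ k by rewrite exprn_gt0.
exists (2 * ((L + 2) / q ^+ k)).
  by rewrite mulr_ge0 // divr_ge0 ?(ltW qk) // addr_ge0.
set g := transfer_mean _ => E r.
have mE i : measurable (E i) by have [] := digit_set_measure R z (nseq i.+1 None ++ run).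
have muE i : mu (E i) = (@pattern_prob R (nseq i.+1 None ++ run) 0)%:E.
  by have [] := digit_set_measure R z (nseq i.+1 None ++ run).
have u0 : 0 <= (0 : R) <= 1 by rewrite lexx ler01.
have le1 i j : (mu (E i `&` E j) <= 1%:E)%E.
  apply: (@le_trans _ _ (mu (E i))).
    apply: le_measure; rewrite ?inE; last exact: subIsetl; last exact: mE.
    exact: measurableI (mE i) (mE j).
  rewrite muE lee_fin; have [_ H] := pattern_prob_lip R (nseq i.+1 None ++ run).
  by have /andP[] := H 0 u0.
have rE i j : mu (E i `&` E j) = (r i j)%:E.
  rewrite /r fineK // ge0_fin_numE ?measure_ge0 //.
  by apply: le_lt_trans (le1 i j) _; rewrite ltry.
have r01 i j : 0 <= r i j <= 1 by rewrite -!lee_fin -rE le1 measure_ge0.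
have rii i : r i i = @pattern_prob R (nseq i.+1 None ++ run) 0.
  by apply: EFin_inj; rewrite -rE setIid muE.
have /andP[g0 g1] : 0 <= g <= 1.
  apply/andP; split.
    rewrite -(transfer_mean_cst (0 : R)).
    by apply: (transfer_mean_le (unit_lip_cst _) hL) => t /h01/andP[].
  rewrite -[leRHS](transfer_mean_cst (1 : R)).
  by apply: (transfer_mean_le hL (unit_lip_cst _)) => t /h01/andP[].
split => // i j ij; rewrite -/q.
have C1 : 0 <= (L + 2) / q ^+ k by rewrite divr_ge0 ?(ltW qk) // addr_ge0.
have [ikj|jik] := leqP (i + k) j.
  have jE : j = (i + k + (j - (i + k)))%N by rewrite subnKC.
  set d := (j - (i + k))%N in jE.
  have [_] := run_quasi_independence i.+1 d hL; rewrite -/g -/q => A2.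
  have [A1 _] := run_quasi_independence j.+1 d hL; rewrite -/g -/q in A1.
  have rij : r i j =
      @pattern_prob R (nseq i.+1 None ++ run ++ nseq d None ++ run) 0.
    apply: EFin_inj; rewrite -rE jE /E -!addSn run_setI.
    by have [] := digit_set_measure R z (nseq i.+1 None ++ run ++ nseq d None ++ run).
  rewrite -/run -rij -rii in A2; rewrite -/run -rii in A1.
  have d1 : q ^+ d * L <= (L + 2) / q ^+ k * q ^+ (j - i).
    have -> : (j - i = d + k)%N by rewrite {1}jE -addnA addKn addnC.
    rewrite exprD (_ : _ * (_ * _) = q ^+ d * (L + 2)); last first.
      by field; rewrite lt0r_neq0.
    by rewrite ler_wpM2l ?exprn_ge0 ?(ltW q0) //; lra.
  have d2 : q ^+ j.+1 * L <= (L + 2) / q ^+ k * q ^+ (j - i).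
    rewrite mulrC; apply: ler_pM => //.
    - by rewrite exprn_ge0 ?ltW.
    - rewrite ler_pdivlMr //; apply: (@le_trans _ _ (L * 1)); last lra.
      by rewrite ler_wpM2l // exprn_ile1 // ltW.
    - by rewrite ler_wiXn2l ?(ltW q0) // (leq_trans (leq_subr _ _)).
  have d3 : g * (g - r j j) <= q ^+ j.+1 * L.
    apply: (@le_trans _ _ (1 * `|r j j - g|)); last by rewrite mul1r.
    apply: (le_trans (ler_norm _)); rewrite normrM distrC ger0_norm //.
    by rewrite ler_wpM2r.
  have d4 := le_trans (ler_norm _) A2.
  (* The first part is the dependence of the second run on the first, the second part the distance
     of [r j j] from its limit; each is at most half of the bound. *)
  have -> : r i j - g * r i i - g * r j j + g ^+ 2 =
    (r i j - g * r i i) + g * (g - r j j) by ring.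
  lra.
have qij : q ^+ k <= q ^+ (j - i).
  by rewrite ler_wiXn2l ?(ltW q0) // leq_subLR ltnW.
have a1 : 2 <= 2 * ((L + 2) / q ^+ k) * q ^+ (j - i).
  rewrite -mulrA ler_peMr // mulrAC ler_pdivlMr // mul1r.
  apply: (le_trans qij); rewrite ler_peMl ?exprn_ge0 ?(ltW q0) //; lra.
apply: le_trans a1.
have /andP[? ?] := r01 i j; have /andP[? ?] := r01 i i; have /andP[? ?] := r01 j j.
have := mulr_ge0 g0 (_ : 0 <= r i i); have := mulr_ge0 g0 (_ : 0 <= r j j).
nra.
Qed.

(** The count starts at position 1, whose run begins with the second digit; hence [i.+1] free digits
    for the summand of index [i]. *)
Lemma cf_run_countE b k x z n : irrational x -> Num.floor x = z ->
  (cf_run_count b.+1 k x n)%:R =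
  \sum_(i < n) \1_(digit_set z (nseq i.+1 None ++ nseq k (Some b))) x :> R.
Proof.
move=> ix xz; rewrite /cf_run_count; elim: n => [|n IHn]; first by rewrite big_ord0.
rewrite -[n.+1]addn1 iotaD count_cat natrD IHn addn1 big_ord_recr /= addn0 add1n.
congr (_ + _); rewrite indicE; congr (nat_of_bool _)%:R.
rewrite cf_digitE //; apply/forallP/idP => [H|].
  apply/mem_set/(@run_setP z b k n.+1 x); split => //; apply/digits_match_run => j jk.
  exact/eqP/(H (Ordinal jk)).
by move=> /set_mem/(@run_setP z b k n.+1 x) [_ _ /digits_match_run H] j; rewrite H.
Qed.

(** The irrationals with floor [z] form a set of measure 1, to which [ae_cvg_average] applies; the
    countably many exceptional null sets are then united. *)
Lemma ae_run_frequency b k :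
  {ae mu, forall x : R, (n%:R^-1 * (cf_run_count b.+1 k x n)%:R : R) @[n --> \oo] -->
    `| log2 (1 + (-1) ^+ k / (genfib b.+1 k.+2)%:R ^+ 2 : R) |}.
Proof.
rewrite -run_frequency; set g := transfer_mean _.
have aeF : Filter (almost_everywhere mu) by exact: ae_filter_ringOfSetsType.
have aez z : {ae mu, forall x : R, digit_set z [::] x ->
    (n%:R^-1 * (cf_run_count b.+1 k x n)%:R : R) @[n --> \oo] --> g}.
  have [C C0 [rE g0 cov]] := run_covariance_le z b k.
  have [mD muD] := digit_set_measure R z [::].
  have V n := sum_sym_geometric_le n C0 _ cov.
  have := @ae_cvg_average _ _ R mu (digit_set z [::])
    (fun i => digit_set z (nseq i.+1 None ++ nseq k (Some b))) _ g (15 * C) mD muD.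
  move=> /(_ _ _ _ rE g0) H.
  apply: filterS (H _ _ _) => [x H1 Dx|i|i x [ix xz _]|n].
  - have [ix xz _] := Dx; rewrite (_ : (fun n => _) = (fun n => n%:R^-1 *
      \sum_(i < n) \1_(digit_set z (nseq i.+1 None ++ nseq k (Some b))) x)).
      exact: H1.
    by apply/funext => n; rewrite (cf_run_countE _ _ _ ix xz).
  - by have [] := digit_set_measure R z (nseq i.+1 None ++ nseq k (Some b)).
  - by [].
  - by apply: V => i j; rewrite setIC; ring.
have aeQ : {ae mu, forall x : R, irrational x}.
  exists rational; split; first exact: rational_measurable.
    exact/countable_lebesgue_measure0/countable_rational.
  by move=> x /contrapT.
have aeall : {ae mu, forall x : R, forall z, digit_set z [::] x ->
    (n%:R^-1 * (cf_run_count b.+1 k x n)%:R : R) @[n --> \oo] --> g}.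
  (* The integers are covered by two families indexed by natural numbers, the nonnegative and the
     negative ones. *)
  have aen := ae_foralln (fun n => aez (Negz n)).
  have aep := ae_foralln (fun n => aez (Posz n)).
  by apply: filterS2 aen aep => x Hn Hp [n|n]; [exact: Hp|exact: Hn].
by apply: filterS2 aeQ aeall => x ix /(_ (Num.floor x)); apply.
Qed.

End RunFrequency.

Theorem theorem1p3 (R : realType) (k : nat) (hk : (0 < k)%N) :
  (forall a : nat, (0 < a)%N ->
    {ae @lebesgue_measure R, forall x : R,
      (n%:R^-1 * (cf_run_count a k x n)%:R : R) @[n --> \oo] -->
        `| log2 (1 + (-1) ^+ k / (genfib a k.+2)%:R ^+ 2) |}) /\
  {ae @lebesgue_measure R, forall x : R,
    (n%:R^-1 * (cf_run_count 1 k x n)%:R : R) @[n --> \oo] -->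
      `| log2 (1 + (-1) ^+ k / (fib k.+2)%:R ^+ 2) |}.
Proof.
split=> [[//|b] _|]; first exact: ae_run_frequency.
have genfib_fib n : genfib 1 n.+1 = fib n.+1.
  elim/ltn_ind: n => -[|[|n]] // IH.
  have -> : genfib 1 n.+3 = (1 * genfib 1 n.+2 + genfib 1 n.+1)%N by [].
  by rewrite mul1n !IH.
by have := ae_run_frequency R 0 k; rewrite genfib_fib.
Qed.
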